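(* Fix integers $r \ge 2$ and $K \geq 1$. Let $\{H_n\}_{n\ge 1}$ be a sequence of $r$-uniform hypergraphs in which each hyperedge $e\in E(H_n)$ carries an integer weight $w_e\in\{1,\dots,K\}$, with vertices colored uniformly at random with $c_n$ colors, where $c_n\to\infty$. For $1\le i\le K$ let $H_n^{(i)}$ be the hypergraph with $V(H_n^{(i)})=V(H_n)$ and $E(H_n^{(i)})=\{e\in E(H_n): w_e=i\}$. Suppose that for each $1 \leq i \leq K$, $$\lim_{n \to \infty}\mathbb{E}\, T(H_n^{(i)}) = \lambda_i \quad\text{and}\quad \lim_{n \to \infty}\mathrm{Var}\, T(H_n^{(i)}) = \lambda_i,$$ where $\lambda_i \geq 0$ is a constant. Then, as $n \to \infty$, $\mathsf{W}(H_n)$ converges in distribution to $\sum_{i=1}^K i\, Z_i$, where $Z_i \sim \mathrm{Pois}(\lambda_i)$, $1\le i\le K$, are independent.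
   Context: An $r$-uniform hypergraph $H=(V(H),E(H))$ consists of a finite vertex set $V(H)$ and a set $E(H)$ of $r$-element subsets of $V(H)$, called hyperedges. ''Colored uniformly at random with $c_n$ colors'' means each vertex $v$ gets a color $X_v$ uniform on $\{1,\dots,c_n\}$, independently over the vertices. With $\mathbf 1\{X_{=e}\}=\mathbf 1\{X_v=X_{v'}\ \forall v,v'\in e\}$, set $T(H)=\sum_{e\in E(H)}\mathbf 1\{X_{=e}\}$ (number of monochromatic hyperedges) and $\mathsf W(H_n)=\sum_{e\in E(H_n)}w_e\mathbf 1\{X_{=e}\}$ (weighted count of monochromatic hyperedges). $\mathrm{Pois}(0)$ is the point mass at $0$. *)

(* Defs.v *)
From HB Require Import structures.
From mathcomp Require Import all_boot all_order all_algebra.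
From mathcomp Require Import all_classical all_reals all_analysis.
From mathcomp Require Import measurable_realfun.

Set Implicit Arguments.
Unset Strict Implicit.
Unset Printing Implicit Defensive.

Import Order.TTheory GRing.Theory Num.Theory.
Import numFieldNormedType.Exports.

Local Open Scope classical_set_scope.
Local Open Scope ring_scope.

(* A hypergraph on the finite vertex set V, given by its set of hyperedges. *)
Definition hypergraph (V : finType) := {set {set V}}.

Definition is_uniform (r : nat) (V : finType) (H : hypergraph V) :=
  forall e, e \in H -> #|e| = r.

(* The vertex set is unchanged: it is carried by the type V. *)
Definition weight_class (V : finType) (H : hypergraph V) (w : {set V} -> nat)
    (i : nat) : hypergraph V :=
  [set e in H | w e == i].

Definition mutually_independent d d' (T : measurableType d)
    (T' : measurableType d') (R : realType) (P : probability T R)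
    (I : finType) (X : I -> {RV P >-> T'}) :=
  forall (J : {set I}) (A : I -> set T'),
    (forall i, i \in J -> measurable (A i)) ->
    P (\bigcap_(i in [set i | i \in J]) (X i @^-1` A i)) =
    (\prod_(i in J) P (X i @^-1` A i))%E.

Arguments mutually_independent {d d' T T' R} P {I} X.

Definition uniform_color d (T : measurableType d) (R : realType)
    (P : probability T R) (c : nat) (X : {RV P >-> nat}) :=
  forall k : nat,
    distribution P X [set k] =
    (if (1 <= k <= c)%N then (c%:R^-1 : R) else 0)%:E.

Arguments uniform_color {d T R} P c X.

Definition random_coloring d (T : measurableType d) (R : realType)
    (P : probability T R) (V : finType) (c : nat) (X : V -> {RV P >-> nat}) :=
  (forall v, uniform_color P c (X v)) /\ mutually_independent P X.

Arguments random_coloring {d T R} P {V} c X.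

(* The second argument of poisson_prob is a dummy; poisson_prob 0 is the point
   mass at 0. *)
Definition poisson_law d (T : measurableType d) (R : realType)
    (P : probability T R) (lambda : R) (Z : {RV P >-> nat}) :=
  forall A : set nat, distribution P Z A = poisson_prob lambda 0 A.

Arguments poisson_law {d T R} P lambda Z.

Definition mono d (T : measurableType d) (V : finType)
    (X : V -> {mfun T >-> nat}) (e : {set V}) : set T :=
  [set t | forall v v', v \in e -> v' \in e -> X v t = X v' t].

Definition mono_count d (T : measurableType d) (R : realType)
    (V : finType) (X : V -> {mfun T >-> nat}) (H : hypergraph V) (t : T) : R :=
  \sum_(e in H) \1_(mono X e) t.

Definition weighted_mono_count d (T : measurableType d) (R : realType)
    (V : finType) (X : V -> {mfun T >-> nat}) (H : hypergraph V) (w : {set V} -> nat) (t : T) : R :=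
  \sum_(e in H) (w e)%:R * \1_(mono X e) t.

(* sum_{i=1}^K i Z_i, the indices being shifted by one: Z i stands for
   Z_{i+1}. *)
Definition compound_sum d (T : measurableType d) (R : realType)
    (K : nat) (Z : 'I_K -> {mfun T >-> nat}) (t : T) : R :=
  \sum_(i < K) i.+1%:R * (Z i t)%:R.

Arguments mono_count {d T R V} X H t.
Arguments weighted_mono_count {d T R V} X H w t.
Arguments compound_sum {d T R K} Z t.

Lemma measurable_mono d (T : measurableType d) (V : finType)
    (X : V -> {mfun T >-> nat}) (e : {set V}) :
  measurable (mono X e).
Proof.
have -> : mono X e = \bigcap_(p in [set: V * V]%classic)
    (if (p.1 \in e) && (p.2 \in e) then
       \bigcup_k (X p.1 @^-1` [set k] `&` X p.2 @^-1` [set k])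
     else setT).
  apply/seteqP; split=> t /=.
    move=> h [v v'] _ /=; case: ifPn => //= /andP[ve v'e].
    by exists (X v t) => //; split => //=; rewrite (h v v').
  move=> h v v' ve v'e; have := h (v, v') I; rewrite /= ve v'e /=.
  by case=> k _ [/= -> ->].
apply: fin_bigcap_measurable => [|p _]; first exact: finite_finset.
case: ifP => // _; apply: bigcup_measurable => k _.
by apply: measurableI; apply: measurable_funPTI.
Qed.

Lemma measurable_weighted_mono_count d (T : measurableType d) (R : realType)
    (V : finType) (X : V -> {mfun T >-> nat}) (H : hypergraph V) (w : {set V} -> nat) :
  measurable_fun setT (weighted_mono_count X H w : T -> R).
Proof.
rewrite /weighted_mono_count.
under eq_fun do rewrite -big_filter.
apply: measurable_sum => e; apply: measurable_funM => //.
by apply: measurable_indic; exact: measurable_mono.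
Qed.

HB.instance Definition _ d (T : measurableType d) (R : realType)
    (V : finType) (X : V -> {mfun T >-> nat}) (H : hypergraph V) (w : {set V} -> nat) :=
  isMeasurableFun.Build _ _ _ _ (weighted_mono_count X H w : T -> R)
    (measurable_weighted_mono_count X H w).

Lemma measurable_compound_sum d (T : measurableType d) (R : realType)
    (K : nat) (Z : 'I_K -> {mfun T >-> nat}) :
  measurable_fun setT (compound_sum Z : T -> R).
Proof.
apply: measurable_sum => i; apply: measurable_funM => //.
have mn : measurable_fun [set: nat] (fun n : nat => n%:R : R) by [].
exact: (measurableT_comp mn).
Qed.

HB.instance Definition _ d (T : measurableType d) (R : realType)
    (K : nat) (Z : 'I_K -> {mfun T >-> nat}) :=
  isMeasurableFun.Build _ _ _ _ (compound_sum Z : T -> R)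
    (measurable_compound_sum Z).

(* Each Y n may live on its own probability space. *)
Definition cvg_in_distribution (d : nat -> measure_display)
    (T : forall n, measurableType (d n)) d' (T' : measurableType d')
    (R : realType) (P : forall n, probability (T n) R) (Q : probability T' R)
    (Y : forall n, {RV (P n) >-> R}) (Y' : {RV Q >-> R}) :=
  forall x : R, {for x, continuous (cdf Y')} ->
    cdf (Y n) x @[n --> \oo] --> cdf Y' x.

Arguments cvg_in_distribution {d T d' T' R} P Q Y Y'.

(* Main.v *)
Require Import Defs.
From mathcomp Require Import all_boot all_order all_algebra.
From mathcomp Require Import all_classical all_reals all_analysis.
From mathcomp Require Import measurable_realfun ring lra zify.

Set Implicit Arguments.
Unset Strict Implicit.
Unset Printing Implicit Defensive.

Import Order.TTheory GRing.Theory Num.Theory.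
Import numFieldNormedType.Exports.

Local Open Scope ring_scope.

(** The proof is a Chen-Stein argument by recoloring, carried out on point
    probabilities.  Write [W] for the weighted count, [q = 1 / c] and
    [p = q ^ (r - 1)], the probability that a given hyperedge is monochromatic.
    Conditioning on [e] being monochromatic amounts to recoloring [e] with the
    color of one of its vertices, its hub ([avg_fmono]).  Expanding
    [k P(W = k)] over the monochromatic hyperedges thus gives
    [sum_e w_e p P(W' = k)], where [W'] is the count after recoloring [e], and
    [W' = W + w_e] unless [e] was monochromatic beforehand or the recoloring
    changes the status of another hyperedge.  If this is rare, the law of [W]
    asymptotically satisfies

      [k P(W = k) = sum_i i lambda_i P(W = k - i)],

    which is the recursion of Panjer for the law of [sum_i i Z_i]
    ([cpmf_panjer]).  The recursion determines a law from its value at [0], and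
    tightness of [W] determines that value ([panjer_pmf_cvg]); hence all point
    probabilities converge, and so do the distribution functions.

    It remains to bound the error, the sum over [e] of [p P(W' <> W + w_e)]
    ([stein_bound]).  The hyperedges that are monochromatic beforehand
    contribute only the mean times [p].
    - Hyperedges that share at least two vertices with [e] contribute a multiple
      of [overlap], the expected number of such pairs that are monochromatic.
      Within one weight class this is at most twice the variance minus the mean,
      up to a vanishing term, and so tends to [0] ([overlap_le_variance]); a
      positive semidefinite form transfers the bound to pairs from different
      classes ([overlap_weight_classes]).
    - Hyperedges that meet [e] in one vertex other than the hub are counted by
      the degrees of the vertices of [e] other than the hub.  A vertex of degree
      above [eps / p] is taken as hub whenever there is one.  The number of such
      vertices stays bounded, and the hyperedges that contain two of them are
      few because of the bound on [overlap] ([exists_hub]). *)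

(** * Uniform random colorings *)

Section UniformColorings.
Variables (R : realFieldType) (V : finType) (c : nat).
Local Notation coloring := {ffun V -> 'I_c}.
Local Notation q := (c%:R^-1 : R).
Implicit Types (F G : coloring -> R) (e f : {set V}) (phi psi : coloring).

Definition avg F : R := (\sum_phi F phi) / #|{: coloring}|%:R.

(** The counterpart of [mono] on the finite space of colorings. *)
Definition fmono e phi : bool :=
  [forall v in e, forall v' in e, phi v == phi v'].

Lemma fmonoP e phi :
  reflect (forall v v', v \in e -> v' \in e -> phi v = phi v') (fmono e phi).
Proof.
apply: (iffP forall_inP) => [h v v' ve v'e|h v ve].
  by have /forall_inP/(_ _ v'e)/eqP := h v ve.
by apply/forall_inP => v' v'e; apply/eqP/h.
Qed.

Definition merge e (u : V) phi : coloring :=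
  [ffun v => if v \in e then phi u else phi v].

Lemma eq_avg F G : F =1 G -> avg F = avg G.
Proof. by move=> FG; congr (_ / _); apply: eq_bigr. Qed.

Lemma avgD F G : avg (fun phi => F phi + G phi) = avg F + avg G.
Proof. by rewrite /avg big_split /= mulrDl. Qed.

Lemma avgZ (a : R) F : avg (fun phi => a * F phi) = a * avg F.
Proof. by rewrite /avg -mulr_sumr mulrA. Qed.

Lemma avgN F : avg (fun phi => - F phi) = - avg F.
Proof. by rewrite /avg sumrN mulNr. Qed.

Lemma avg_sum (I : finType) (A : pred I) (F : I -> coloring -> R) :
  avg (fun phi => \sum_(i | A i) F i phi) = \sum_(i | A i) avg (F i).
Proof. by rewrite /avg exchange_big /= mulr_suml. Qed.

Lemma ler_avg F G : (forall phi, F phi <= G phi) -> avg F <= avg G.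
Proof. by move=> FG; rewrite /avg ler_wpM2r ?invr_ge0 ?ler0n// ler_sum. Qed.

Lemma avg_ge0 F : (forall phi, 0 <= F phi) -> 0 <= avg F.
Proof. by move=> F0; rewrite /avg divr_ge0 ?ler0n// sumr_ge0. Qed.

Lemma ler_norm_avg F : `|avg F| <= avg (fun phi => `|F phi|).
Proof.
rewrite /avg normrM [X in _ * X]ger0_norm ?invr_ge0 ?ler0n//.
by rewrite ler_wpM2r ?invr_ge0 ?ler0n ?ler_norm_sum.
Qed.

Hypothesis c_gt0 : (0 < c)%N.

Lemma natc_neq0 : c%:R != 0 :> R.
Proof. by rewrite pnatr_eq0 -lt0n. Qed.

Lemma q_gt0 : 0 < q. Proof. by rewrite invr_gt0 ltr0n. Qed.

Lemma q_le1 : q <= 1.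
Proof. by rewrite invf_le1 ?ler1n ?ltr0n. Qed.

Lemma avg_cst (a : R) : avg (fun=> a) = a.
Proof.
rewrite /avg sumr_const -[X in X / _]mulr_natr mulfK// pnatr_eq0 card_ffun card_ord.
by rewrite -lt0n expn_gt0 c_gt0.
Qed.

Lemma fmono_merge e u phi : u \in e -> fmono e (merge e u phi).
Proof. by move=> ue; apply/fmonoP => v v' ve v'e; rewrite !ffunE ve v'e. Qed.

(** A coloring in the fiber is free on [e :\ u] and prescribed elsewhere. *)
Lemma card_merge_fiber e u psi : u \in e -> fmono e psi ->
  #|[pred phi | merge e u phi == psi]| = (c ^ #|e|.-1)%N.
Proof.
move=> ue /fmonoP psie.
have -> : (c ^ #|e|.-1 = \prod_v if v \in e :\ u then c else 1)%N.
  rewrite -big_mkcond /= prod_nat_const; congr (_ ^ _)%N.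
  by rewrite (cardsD1 u e) ue.
transitivity #|family (fun v => [pred k | (v \in e :\ u) || (k == psi v)])|.
  apply: eq_card => phi; rewrite !inE; apply/eqP/familyP.
    move=> <- v; rewrite !inE ffunE; case: (eqVneq v u) => [->|vu] /=.
      by rewrite ue.
    by case: (v \in e) => /=.
  move=> h; apply/ffunP => v; rewrite ffunE.
  have hu : phi u = psi u by have := h u; rewrite !inE eqxx => /eqP.
  case: ifPn => ve; first by rewrite hu; apply: psie.
  by have := h v; rewrite !inE (negbTE ve) andbF => /eqP.
rewrite card_family foldrE big_map enumT; apply: eq_bigr => v _.
case: ifPn => ve.
  by rewrite -[RHS]card_ord; apply: eq_card => k; rewrite !inE.
by rewrite -[RHS](card1 (psi v)); apply: eq_card => k; rewrite !inE.
Qed.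

(** Conditioning on [e] being monochromatic amounts to recoloring [e] with the
    color of one of its vertices: every coloring that is constant on [e] is the
    recoloring of exactly [c ^ (#|e| - 1)] colorings. *)
Lemma avg_fmono e u F : u \in e ->
  avg (fun phi => (fmono e phi)%:R * F phi) =
  q ^+ #|e|.-1 * avg (fun phi => F (merge e u phi)).
Proof.
move=> ue; rewrite /avg mulrA; congr (_ / _).
have -> : \sum_phi F (merge e u phi) =
    c%:R ^+ #|e|.-1 * \sum_phi (fmono e phi)%:R * F phi.
  rewrite (partition_big (merge e u) predT)//= mulr_sumr.
  apply: eq_bigr => psi _.
  rewrite (eq_bigr (fun=> F psi)); last by move=> phi /eqP ->.
  rewrite sumr_const; case: (boolP (fmono e psi)) => he.
    by rewrite mul1r card_merge_fiber// -[LHS]mulr_natl natrX.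
  rewrite mul0r mulr0 [X in _ *+ X](_ : _ = 0%N) ?mulr0n//.
  apply: eq_card0 => phi; apply/negP => hphi; case/negP: he.
  have /eqP <- : merge e u phi == psi by exact: hphi.
  exact: fmono_merge.
by rewrite mulrA -exprMn mulVf ?natc_neq0// expr1n mul1r.
Qed.

Lemma avg_fmono1 e : e != finset.set0 ->
  avg (fun phi => (fmono e phi)%:R) = q ^+ #|e|.-1.
Proof.
case/set0Pn => u ue; under eq_avg do rewrite -[_%:R]mulr1.
by rewrite (avg_fmono (fun=> 1) ue) avg_cst mulr1.
Qed.

Lemma fmonoU e f phi : e :&: f != finset.set0 ->
  fmono (e :|: f) phi = fmono e phi && fmono f phi.
Proof.
case/set0Pn => x /[!inE] /andP[xe xf].
apply/fmonoP/andP => [h|[/fmonoP he /fmonoP hf] v v'].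
  by split; apply/fmonoP => v v' hv hv'; apply: h; rewrite inE ?hv ?hv' ?orbT.
have hx w : w \in e :|: f -> phi w = phi x.
  by rewrite inE => /orP[we|wf]; [apply: he|apply: hf].
by move=> /hx -> /hx ->.
Qed.

Lemma avg_fmono2_meet e f : e :&: f != finset.set0 ->
  avg (fun phi => (fmono e phi)%:R * (fmono f phi)%:R) = q ^+ #|e :|: f|.-1.
Proof.
move=> ef; rewrite -avg_fmono1.
  by apply: eq_avg => phi; rewrite fmonoU// -natrM mulnb.
by apply: contraNneq ef => /eqP; rewrite finset.setU_eq0 => /andP[/eqP -> _]; rewrite finset.set0I.
Qed.

(** If [e] and [f] share at most one vertex, this vertex can be the one whose
    color is kept, and then recoloring [e] does not change the colors on [f]. *)
Lemma avg_fmono2_indep e f : e != finset.set0 -> f != finset.set0 ->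
  (#|e :&: f| <= 1)%N ->
  avg (fun phi => (fmono e phi)%:R * (fmono f phi)%:R) =
  q ^+ #|e|.-1 * q ^+ #|f|.-1.
Proof.
move=> e0 f0 ef.
have [u ue uP] : exists2 u, u \in e & forall v, v \in e -> v \in f -> v = u.
  case: (eqVneq (e :&: f) finset.set0) => [ef0|/set0Pn[u uef]].
    case/set0Pn: e0 => u ue; exists u => // v ve vf.
    have : v \in e :&: f by rewrite inE ve vf.
    by rewrite ef0 inE.
  move: (uef); rewrite inE => /andP[ue uf]; exists u => // v ve vf.
  by apply: (card_le1_eqP ef) => //; rewrite inE ve vf.
rewrite (avg_fmono _ ue) -(avg_fmono1 f0); congr (_ * _); apply: eq_avg => phi.
have mf w : w \in f -> merge e u phi w = phi w.
  by move=> wf; rewrite ffunE; case: ifPn => // we; rewrite (uP w).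
congr (_ %:R); congr nat_of_bool.
apply/fmonoP/fmonoP => h v v' vf v'f; first by rewrite -(mf v)// -(mf v')//; apply: h.
by rewrite !mf//; apply: h.
Qed.

End UniformColorings.
(** * Overlapping hyperedges and the variance *)

Section Uniform.
Variables (V : finType) (r : nat).
Implicit Types (e f : {set V}) (H : hypergraph V).

Lemma uniform_neq0 H e : (2 <= r)%N -> is_uniform r H -> e \in H -> e != finset.set0.
Proof. by move=> r2 Hr eH; rewrite -card_gt0 Hr//; lia. Qed.

Lemma card_meet_lt H e f : is_uniform r H -> e \in H -> f \in H -> f != e ->
  (#|e :&: f| < r)%N.
Proof.
move=> Hr eH fH fe; rewrite -(Hr e)//.
apply: proper_card; rewrite finset.properEneq finset.subsetIl andbT.
apply: contraNneq fe => efe; rewrite eq_sym eqEcard (Hr e)// (Hr f)// leqnn.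
by rewrite andbT -efe finset.subsetIr.
Qed.

Lemma card_union_uniform H e f : is_uniform r H -> e \in H -> f \in H ->
  #|e :|: f| = (2 * r - #|e :&: f|)%N.
Proof. by move=> Hr eH fH; rewrite cardsU (Hr e eH) (Hr f fH) addnn mul2n. Qed.

Lemma uniform_weight_class H (w : {set V} -> nat) i : is_uniform r H ->
  is_uniform r (weight_class H w i).
Proof. by move=> Hr e; rewrite inE => /andP[eH _]; apply: Hr. Qed.

Lemma sum_weight_class (U : nmodType) (K : nat) H (w : {set V} -> nat)
    (F : {set V} -> U) :
  (forall e, e \in H -> (1 <= w e <= K)%N) ->
  \sum_(e in H) F e = \sum_(i < K) \sum_(e in weight_class H w i.+1) F e.
Proof.
move=> wK.
under [RHS]eq_bigr do rewrite big_mkcond /=; rewrite exchange_big /= big_mkcond.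
apply: eq_bigr => e _; case: ifPn => eH; last first.
  by rewrite big1// => i _; rewrite inE (negbTE eH).
have /andP[w0 wle] := wK e eH.
have wlt : ((w e).-1 < K)%N by lia.
rewrite (bigD1 (Ordinal wlt))//= inE eH prednK// eqxx big1 ?addr0// => i iw.
rewrite inE eH /=; case: eqP => // wi; case/eqP: iw; apply: val_inj => /=.
by rewrite wi.
Qed.

End Uniform.

Section Overlaps.
Variables (R : realFieldType) (V : finType) (c r : nat).
Local Notation q := (c%:R^-1 : R).
Implicit Types (e f S : {set V}) (H : hypergraph V).

(** The expected number of ordered pairs of distinct hyperedges that share at
    least two vertices and are both monochromatic. *)
Definition overlap H : R :=
  \sum_(e in H) \sum_(f in H | (f != e) && (2 <= #|e :&: f|)%N)
    q ^+ #|e :|: f|.-1.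

Definition count H (phi : {ffun V -> 'I_c}) : R :=
  \sum_(e in H) (fmono e phi)%:R.

(** A positive semidefinite kernel, by [sum_kernel], which for distinct
    hyperedges sharing at least two vertices is comparable to
    [q ^+ #|e :|: f|.-1].  The restriction to [#|S| < r] keeps its diagonal
    negligible. *)
Definition kernel e f : R :=
  \sum_(S : {set V} | (S \subset e :&: f) && (2 <= #|S| < r)%N)
    q ^+ (2 * r - 1 - #|S|).

Hypotheses (r_ge2 : (2 <= r)%N) (c_gt0 : (0 < c)%N).

Let q0 : 0 < q := q_gt0 R c_gt0.
Let q1 : q <= 1 := q_le1 R c_gt0.

Lemma ler_qX m n : (m <= n)%N -> q ^+ n <= q ^+ m.
Proof. by move=> mn; rewrite ler_wiXn2l// ltW. Qed.

Lemma avg_count H : is_uniform r H -> avg (count H) = #|H|%:R * q ^+ r.-1.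
Proof.
move=> Hr; rewrite /count avg_sum (eq_bigr (fun=> q ^+ r.-1)).
  by rewrite sumr_const mulr_natl.
by move=> e eH; rewrite avg_fmono1 ?Hr//; exact: uniform_neq0 Hr eH.
Qed.

Lemma overlap_ge0 H : 0 <= overlap H.
Proof. by apply: sumr_ge0 => e _; apply: sumr_ge0 => f _; rewrite exprn_ge0// ltW. Qed.

(** Distinct hyperedges sharing at most one vertex are uncorrelated.  For those
    sharing at least two, the product of the probabilities is at most
    [q <= 1 / 2] times the joint probability, so the covariance is at least half
    of the latter.  The diagonal contributes the mean up to a factor [1 - p]. *)
Lemma overlap_le_variance H : is_uniform r H -> (2 <= c)%N ->
  overlap H <= 2 * (avg (fun phi => (count H phi - avg (count H)) ^+ 2)
                    - avg (count H) + avg (count H) * q ^+ r.-1).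
Proof.
move=> Hr c2; have q2 : q <= 2^-1 by rewrite lef_pV2 ?posrE ?ltr0n ?ler_nat.
set p := q ^+ r.-1; set mu := avg (count H).
have p0 : 0 <= p by rewrite exprn_ge0// ltW.
have muE : mu = \sum_(e in H) p.
  by rewrite /mu avg_count// sumr_const mulr_natl.
have -> : avg (fun phi => (count H phi - mu) ^+ 2) =
    avg (fun phi => count H phi * count H phi) - mu * mu.
  rewrite (_ : (fun phi => _) = fun phi =>
     count H phi * count H phi + ((- (2 * mu)) * count H phi + mu * mu)).
    by rewrite !avgD (avgZ (- (2 * mu)) (count H)) avg_cst// -/mu; ring.
  by apply/funext => phi; ring.
have -> : avg (fun phi => count H phi * count H phi) =
    \sum_(e in H) \sum_(f in H) avg (fun phi : {ffun V -> 'I_c} =>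
      (fmono e phi)%:R * (fmono f phi)%:R).
  under eq_bigr do rewrite -avg_sum; rewrite -avg_sum; apply: eq_avg => phi.
  by rewrite /count mulr_suml; apply: eq_bigr => e _; rewrite mulr_sumr.
have -> : mu * mu = \sum_(e in H) \sum_(f in H) p * p.
  rewrite {1}muE mulr_suml; apply: eq_bigr => e _.
  by rewrite muE mulr_sumr.
have -> : forall x : R, x - mu + mu * p = x - mu * (1 - p) by move=> x; ring.
rewrite muE mulr_suml -!sumrB mulr_sumr; apply: ler_sum => e eH.
rewrite -sumrB.
have -> : p * (1 - p) = \sum_(f in H) (f == e)%:R * (p * (1 - p)).
  rewrite (bigD1 e)//= eqxx mul1r big1 ?addr0// => f /andP[_ /negbTE ->].
  by rewrite mul0r.
rewrite -sumrB mulr_sumr big_mkcondr; apply: ler_sum => f fH.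
have e0 := uniform_neq0 r_ge2 Hr eH; have f0 := uniform_neq0 r_ge2 Hr fH.
case: (eqVneq f e) => [->|fe] /=.
  rewrite avg_fmono2_meet ?finset.setIid// finset.setUid Hr// -/p.
  lra.
rewrite mul0r subr0; case: ifPn => [ef2|]; last first.
  rewrite -ltnNge ltnS => ef1.
  by rewrite avg_fmono2_indep// !Hr// -/p subrr mulr0.
rewrite avg_fmono2_meet//; last by rewrite -card_gt0; lia.
have : p * p <= q * q ^+ #|e :|: f|.-1.
  rewrite -exprS -exprD; apply: ler_qX; rewrite (card_union_uniform Hr)//.
  by have := card_meet_lt Hr eH fH fe; lia.
have : q * q ^+ #|e :|: f|.-1 <= 2^-1 * q ^+ #|e :|: f|.-1.
  by rewrite ler_wpM2r ?exprn_ge0// ltW.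
lra.
Qed.

Lemma kernel_ge0 e f : 0 <= kernel e f.
Proof. by apply: sumr_ge0 => S _; rewrite exprn_ge0// ltW. Qed.

(** The summand [S = e :&: f] of the kernel alone suffices. *)
Lemma overlap_le_kernel H : is_uniform r H ->
  overlap H <= \sum_(e in H) \sum_(f in H) kernel e f.
Proof.
move=> Hr; apply: ler_sum => e eH; rewrite big_mkcondr; apply: ler_sum => f fH.
case: ifP => [/andP[fe ef2]|_]; last exact: kernel_ge0.
rewrite /kernel (bigD1 (e :&: f))/=; last first.
  by rewrite subxx ef2 (card_meet_lt Hr).
rewrite (card_union_uniform Hr)// -subn1 subnAC lerDl.
by apply: sumr_ge0 => S _; rewrite exprn_ge0// ltW.
Qed.

Lemma kernel_le H e f : is_uniform r H -> e \in H -> f \in H ->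
  kernel e f <= (2 ^ r)%:R *
    (if f == e then q ^+ r
     else if (2 <= #|e :&: f|)%N then q ^+ #|e :|: f|.-1 else 0).
Proof.
move=> Hr eH fH; set b := (if _ then _ else _).
have efr : (#|e :&: f| <= r)%N by rewrite -(Hr e)// subset_leq_card// finset.subsetIl.
have b0 : 0 <= b by rewrite /b; do 2?case: ifP => _; rewrite // exprn_ge0// ltW.
rewrite /kernel; apply: (@le_trans _ _ (\sum_(S in powerset (e :&: f)) b)).
  under [leRHS]eq_bigl do rewrite inE.
  rewrite big_mkcondr; apply: ler_sum => S Sef.
  case: ifP => // /andP[S2 Sr]; have Sc := subset_leq_card Sef.
  rewrite /b; case: eqP => _; first by apply: ler_qX; lia.
  rewrite ifT ?(leq_trans S2)//; apply: ler_qX.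
  by rewrite (card_union_uniform Hr)//; lia.
rewrite sumr_const card_powerset -[_ *+ _]mulr_natl ler_wpM2r// ler_nat.
by rewrite leq_exp2l.
Qed.

Definition codegree H S : R := \sum_(e in H) (S \subset e)%:R.

Lemma sum_kernel H : \sum_(e in H) \sum_(f in H) kernel e f =
  \sum_(S : {set V} | (2 <= #|S| < r)%N)
    q ^+ (2 * r - 1 - #|S|) * codegree H S ^+ 2.
Proof.
transitivity (\sum_(e in H) \sum_(f in H) \sum_(S : {set V} | (2 <= #|S| < r)%N)
    (S \subset e :&: f)%:R * q ^+ (2 * r - 1 - #|S|)).
  apply: eq_bigr => e _; apply: eq_bigr => f _.
  rewrite /kernel big_mkcondl; apply: eq_bigr => S _.
  by case: ifP => _; rewrite ?mul1r ?mul0r.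
under eq_bigr do rewrite exchange_big /=; rewrite exchange_big /=.
apply: eq_bigr => S _; rewrite /codegree expr2 mulr_suml mulr_sumr.
apply: eq_bigr => e _; rewrite !mulr_sumr; apply: eq_bigr => f _.
by rewrite finset.subsetI -mulnb natrM mulrC.
Qed.

Lemma sqr_sum_le (K : nat) (x : 'I_K -> R) :
  (\sum_i x i) ^+ 2 <= K%:R * \sum_i x i ^+ 2.
Proof.
have -> : K%:R * \sum_i x i ^+ 2 =
    \sum_(i < K) \sum_(j < K) (x i ^+ 2 + x j ^+ 2) / 2.
  under [RHS]eq_bigr do rewrite -mulr_suml big_split /= sumr_const card_ord.
  rewrite -mulr_suml big_split /= sumr_const card_ord -sumrMnl -[_ *+ K]mulr_natl.
  rewrite (_ : \sum_(i < K) x i ^+ 2 *+ K = K%:R * \sum_i x i ^+ 2); first by field.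
  by rewrite mulr_sumr; apply: eq_bigr => i _; rewrite mulr_natl.
rewrite expr2 mulr_suml; apply: ler_sum => i _.
rewrite mulr_sumr; apply: ler_sum => j _.
have := sqr_ge0 (x i - x j); rewrite sqrrB; lra.
Qed.

Variables (K : nat) (H : hypergraph V) (w : {set V} -> nat).
Hypotheses (Hr : is_uniform r H) (wK : forall e, e \in H -> (1 <= w e <= K)%N).

(** Means and variances are known for each weight class separately.  Overlaps between
    different classes are controlled because, up to constants and diagonal
    terms, the overlap is the positive semidefinite form associated with
    [kernel]. *)
Lemma overlap_weight_classes : overlap H <= (K * 2 ^ r)%:R *
  \sum_(i < K) (overlap (weight_class H w i.+1)
                + #|weight_class H w i.+1|%:R * q ^+ r).
Proof.
apply: (le_trans (overlap_le_kernel Hr)).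
rewrite sum_kernel natrM -mulrA mulr_sumr.
apply: (@le_trans _ _ (K%:R * \sum_(i < K) \sum_(e in weight_class H w i.+1)
    \sum_(f in weight_class H w i.+1) kernel e f)).
  under [X in _ <= _ * X]eq_bigr do rewrite sum_kernel.
  rewrite exchange_big mulr_sumr /=; apply: ler_sum => S _.
  rewrite -mulr_sumr [leRHS]mulrCA ler_wpM2l ?exprn_ge0 ?(ltW q0)//.
  by rewrite /codegree (sum_weight_class _ wK) sqr_sum_le.
rewrite ler_wpM2l ?ler0n//; apply: ler_sum => i _.
set Hi := weight_class H w i.+1; have Hir : is_uniform r Hi by exact: uniform_weight_class.
have -> : #|Hi|%:R * q ^+ r = \sum_(e in Hi) q ^+ r.
  by rewrite sumr_const mulr_natl.
rewrite -big_split /= mulr_sumr.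
apply: ler_sum => e eH.
apply: (le_trans (ler_sum _ (fun f fH => kernel_le Hir eH fH))).
rewrite -mulr_sumr ler_wpM2l ?ler0n//.
rewrite (bigD1 e)//= eqxx addrC lerD2r.
rewrite (eq_bigr (fun f => if (2 <= #|e :&: f|)%N then q ^+ #|e :|: f|.-1
                           else 0)); last by move=> f /andP[_ /negbTE ->].
rewrite -big_mkcondr/= le_eqVlt; apply/orP; left; apply/eqP.
by apply: eq_bigl => f; rewrite andbA.
Qed.

End Overlaps.
(** * The recoloring bound *)

Section SteinRecursion.
Variables (R : realFieldType) (V : finType) (c r K : nat).
Variables (H : hypergraph V) (w : {set V} -> nat).
Local Notation q := (c%:R^-1 : R).
Local Notation p := (q ^+ r.-1).
Hypotheses (r_ge2 : (2 <= r)%N) (c_gt0 : (0 < c)%N).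
Hypotheses (Hr : is_uniform r H) (wK : forall e, e \in H -> (w e <= K)%N).
Implicit Types (e f S A : {set V}) (phi : {ffun V -> 'I_c}).

Let q0 : 0 < q := q_gt0 R c_gt0.
Let p0 : 0 < p. Proof. by rewrite exprn_gt0. Qed.

Definition wcount phi : nat := \sum_(e in H) (w e * fmono e phi)%N.

Definition pmf (k : nat) : R := avg (fun phi => (wcount phi == k)%:R).

(** The probability that recoloring [e] with the color of [u] does more to the
    count than adding the weight of [e]. *)
Definition discrepancy (u : V) e : R :=
  avg (fun phi => (wcount (merge e u phi) != wcount phi + w e)%:R).

Definition degree (x : V) : nat := #|[set f in H | x \in f]|.

Lemma sum_degree_meet A : \sum_(x in A) degree x = \sum_(f in H) #|f :&: A|.
Proof.
transitivity (\sum_(x in A) \sum_(f in H) (x \in f : nat))%N.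
  apply: eq_bigr => x _; rewrite /degree -sum1_card big_mkcond /=.
  rewrite [RHS]big_mkcond /=; apply: eq_bigr => f _; rewrite inE.
  by case: (f \in H); case: (x \in f).
rewrite exchange_big /=; apply: eq_bigr => f _.
rewrite -sum1_card big_mkcond /= [RHS]big_mkcond; apply: eq_bigr => x _.
by rewrite !inE andbC; case: (x \in f); case: (x \in A).
Qed.

(** Expanding [k = wcount phi] over the monochromatic hyperedges on the event
    [wcount phi = k], and recoloring each of these hyperedges. *)
Lemma pmf_recursion (u : {set V} -> V) (k : nat) :
  (forall e, e \in H -> u e \in e) ->
  `| k%:R * pmf k - \sum_(e in H) (w e)%:R * p *
       avg (fun phi : {ffun V -> 'I_c} => (wcount phi + w e == k)%N%:R) | <=
  K%:R * \sum_(e in H) p * discrepancy (u e) e.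
Proof.
move=> ue.
have -> : k%:R * pmf k = \sum_(e in H) (w e)%:R * p *
     avg (fun phi => (wcount (merge e (u e) phi) == k)%:R).
  rewrite -(avgZ k%:R (fun phi => (wcount phi == k)%:R)).
  transitivity (avg (fun phi : {ffun V -> 'I_c} => \sum_(e in H)
      (w e)%:R * ((fmono e phi)%:R * (wcount phi == k)%:R) : R)).
    apply: eq_avg => phi; case: eqP => [<-|_]; last first.
      by rewrite mulr0 big1// => e _; rewrite !mulr0.
    rewrite mulr1 /wcount natr_sum; apply: eq_bigr => e _.
    by rewrite mulr1 natrM.
  rewrite avg_sum; apply: eq_bigr => e eH; rewrite avgZ.
  rewrite (avg_fmono c_gt0 (fun phi => (wcount phi == k)%:R) (ue e eH)).
  by rewrite Hr// mulrA.
rewrite -sumrB mulr_sumr; apply: (le_trans (ler_norm_sum _ _ _)).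
apply: ler_sum => e eH; rewrite -mulrBr -avgN -avgD normrM.
rewrite ger0_norm ?mulr_ge0 ?ler0n ?(ltW p0)// -mulrA.
apply: ler_pM; rewrite ?ler0n ?mulr_ge0 ?normr_ge0 ?(ltW p0) ?ler_nat ?wK//.
rewrite ler_wpM2l ?(ltW p0)//; apply: (le_trans (ler_norm_avg _)).
apply: ler_avg => phi /=; case: (eqVneq (wcount (merge e (u e) phi)) (wcount phi + w e)%N) => [->|_].
  by rewrite subrr normr0.
by do 2!case: eqP => _ /=; rewrite ?subrr ?subr0 ?sub0r ?normrN ?normr0 ?normr1.
Qed.

(** A hyperedge [f] that avoids [e :\ u] has the same colors before and after
    the recoloring, so it contributes equally to both counts. *)
Lemma wcount_merge_neq_le u e phi : u \in e -> e \in H ->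
  (wcount (merge e u phi) != wcount phi + w e <=
   fmono e phi + \sum_(f in H | (f != e) && (f :&: (e :\ u) != finset.set0))
     (fmono f (merge e u phi) + fmono f phi))%N.
Proof.
move=> ue eH; set B := (X in (_ <= X)%N).
case: (posnP B) => [|B0]; last by apply: leq_trans B0; apply: leq_b1.
move=> /eqP; rewrite addn_eq0 eqb0 sum_nat_eq0 => /andP[/negbTE fe0 /forall_inP far].
have -> : wcount (merge e u phi) = (wcount phi + w e)%N; last by rewrite eqxx.
rewrite /wcount (bigD1 e)//= fmono_merge// muln1 addnC; congr (_ + _)%N.
rewrite [RHS](bigD1 e)//= fe0 muln0 add0n; apply: eq_bigr => f /andP[fH fe].
congr (_ * nat_of_bool _)%N.
have [fe0'|fe1] := eqVneq (f :&: (e :\ u)) finset.set0; last first.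
  have := far f; rewrite fH fe fe1 addn_eq0 !eqb0 => /(_ isT) /andP[].
  by move=> /negbTE -> /negbTE ->.
have mf x : x \in f -> merge e u phi x = phi x.
  move=> xf; rewrite ffunE; case: ifPn => // xe.
  case: (eqVneq x u) => [->//|xu].
  have : x \in f :&: (e :\ u) by rewrite !inE xf xu.
  by rewrite fe0' inE.
apply/fmonoP/fmonoP => h x y xf yf; last by rewrite !mf//; apply: h.
by rewrite -(mf x)// -(mf y)//; apply: h.
Qed.

(** The three terms come from [e] itself being monochromatic already, from the
    [f] sharing at least two vertices with [e], and from the [f] meeting [e] in
    a single vertex different from [u e].  In the last case [e] and [f] are
    independent and the number of such [f] is at most a sum of degrees. *)
Lemma sum_discrepancy_le (u : {set V} -> V) :
  (forall e, e \in H -> u e \in e) ->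
  \sum_(e in H) p * discrepancy (u e) e <=
  #|H|%:R * p ^+ 2 + 2 * overlap R c H
  + 2 * p ^+ 2 * (\sum_(e in H) \sum_(x in e :\ u e) degree x)%:R.
Proof.
move=> ue.
have -> : #|H|%:R * p ^+ 2 = \sum_(e in H) p ^+ 2.
  by rewrite sumr_const mulr_natl.
rewrite natr_sum /overlap !mulr_sumr -!big_split /=; apply: ler_sum => e eH.
have e0 := uniform_neq0 r_ge2 Hr eH.
apply: (@le_trans _ _ (p * avg (fun phi : {ffun V -> 'I_c} => (fmono e phi)%:R +
   \sum_(f in H | (f != e) && (f :&: (e :\ u e) != finset.set0))
     ((fmono f (merge e (u e) phi))%:R + (fmono f phi)%:R)))).
  rewrite ler_wpM2l ?(ltW p0)//; apply: ler_avg => phi.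
  under eq_bigr do rewrite -natrD; rewrite -natr_sum -natrD ler_nat.
  exact: wcount_merge_neq_le (ue e eH) eH.
rewrite avgD avg_fmono1// Hr// mulrDr -expr2 -addrA lerD2l.
rewrite avg_sum mulr_sumr.
have degE : (\sum_(x in e :\ u e) degree x)%:R =
    \sum_(f in H) #|f :&: (e :\ u e)|%:R :> R.
  rewrite -natr_sum; congr (_ %:R).
  exact: sum_degree_meet.
rewrite degE !mulr_sumr big_mkcondr [X in X + _]big_mkcondr -big_split /=.
apply: ler_sum => f fH.
have f0 := uniform_neq0 r_ge2 Hr fH.
have p2 : 0 <= p ^+ 2 by rewrite sqr_ge0.
have q2 : 0 <= q ^+ #|e :|: f|.-1 by rewrite exprn_ge0 ?ltW.
case: (eqVneq f e) => [->|fe] /=; first by rewrite add0r !mulr_ge0 ?ler0n.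
case: ifPn => [fu|_]; last by case: ifP => _; rewrite addr_ge0 ?mulr_ge0 ?ler0n.
have fu1 : 1 <= #|f :&: (e :\ u e)|%:R :> R by rewrite ler1n card_gt0.
rewrite avgD avg_fmono1// Hr// mulrDr -expr2.
have := avg_fmono c_gt0 (fun phi => (fmono f phi)%:R : R) (ue e eH).
rewrite Hr// => <-.
set n := #|f :&: _|%:R in fu1 *; set Q := q ^+ #|e :|: f|.-1 in q2 *.
set P := p ^+ 2 in p2 *.
have Pn : P <= P * n by rewrite ler_peMr.
case: ifPn => [ef2|].
  rewrite avg_fmono2_meet//; last by rewrite -card_gt0 (ltn_trans _ ef2).
  have : P <= Q.
    rewrite /P /Q -exprM; apply: ler_qX => //.
    rewrite (card_union_uniform Hr)// -subn1 -subnDA.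
    have -> : (r.-1 * 2 = 2 * r - 2)%N by rewrite -subn1 mulnBl mulnC.
    by rewrite leq_sub2l// addn1 ltnW.
  rewrite -/Q -mulrA => PQ.
  have Pn0 : 0 <= P * n := le_trans p2 Pn.
  by rewrite !mulr_natl !mulr2n lerD ?lerDl// (le_trans Pn)// lerDl.
rewrite -leqNgt => ef1; rewrite avg_fmono2_indep// (Hr eH) (Hr fH).
rewrite -expr2 -/P -mulrA.
by rewrite add0r mulr_natl mulr2n lerD.
Qed.

Definition high (D : R) : {set V} := [set x | D < (degree x)%:R].

Lemma card_high_le (D : R) : #|high D|%:R * D <= (r * #|H|)%:R.
Proof.
apply: (@le_trans _ _ (\sum_(x in high D) degree x)%:R).
  rewrite natr_sum mulr_natl -sumr_const; apply: ler_sum => x.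
  by rewrite inE => /ltW.
rewrite ler_nat sum_degree_meet mulnC -sum_nat_const; apply: leq_sum => f fH.
by rewrite -(Hr fH) subset_leq_card// finset.subsetIl.
Qed.

(** Two hyperedges with the same trace [S] on [A] overlap in at least [#|S|]
    vertices, so a trace with at least two vertices cannot be shared by many
    hyperedges. *)
Lemma card_trace_le A S : (2 <= #|S|)%N ->
  (p * #|[set e in H | e :&: A == S]|%:R) ^+ 2 <=
  overlap R c H + p ^+ 2 * #|H|%:R.
Proof.
move=> S2; set B := finset _.
have BP e : e \in B -> (e \in H) && (e :&: A == S) by rewrite inE.
have P0 : 0 <= p ^+ 2 by rewrite sqr_ge0.
have -> : (p * #|B|%:R) ^+ 2 = \sum_(e in B) \sum_(f in B) p ^+ 2.
  by rewrite !sumr_const -mulrnA -[RHS]mulr_natr natrM exprMn -expr2.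
have -> : p ^+ 2 * #|H|%:R = \sum_(e in H) p ^+ 2.
  by rewrite sumr_const mulr_natr.
rewrite /overlap -big_split /= big_mkcond [leRHS]big_mkcond /=.
apply: ler_sum => e _; case: ifPn => [/BP/andP[eH /eqP eS]|_]; last first.
  case: ifP => // _; apply: addr_ge0 => //; apply: sumr_ge0 => f _.
  by rewrite exprn_ge0// ltW.
rewrite eH (bigD1 e) ?inE ?eH ?eS ?eqxx//= addrC lerD2r.
rewrite big_mkcond [leRHS]big_mkcond /=; apply: ler_sum => f _.
case: ifPn => [/andP[/BP/andP[fH /eqP fS] fe]|_]; last first.
  by case: ifP => // _; rewrite exprn_ge0// ltW.
have ef2 : (2 <= #|e :&: f|)%N.
  apply: (leq_trans S2); rewrite subset_leq_card// finset.subsetI.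
  by rewrite -{1}eS -fS !finset.subsetIl.
rewrite fH fe ef2 /= -exprM; apply: ler_qX => //.
rewrite (card_union_uniform Hr)// -subn1 -subnDA.
have -> : (r.-1 * 2 = 2 * r - 2)%N by rewrite -subn1 mulnBl mulnC.
by rewrite leq_sub2l// addn1 ltnW.
Qed.

Definition hub (x0 : V) A e : V :=
  odflt (odflt x0 [pick x in e]) [pick x in e :&: A].

Lemma hub_in x0 A e : e \in H -> hub x0 A e \in e.
Proof.
move=> eH; rewrite /hub; case: (pickP [pred x | x \in e :&: A]) => [x|_] /=.
  by rewrite inE => /andP[].
case: pickP => //= e0; have /set0Pn[x xe] := uniform_neq0 r_ge2 Hr eH.
by have := e0 x; rewrite xe.
Qed.

(** When [e] has at most one vertex of high degree, that vertex is the hub and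
    all others have degree at most [D]; otherwise degrees are bounded by
    [#|H|]. *)
Lemma hub_degree_le x0 (D : R) e : 0 <= D -> e \in H ->
  (\sum_(x in e :\ hub x0 (high D) e) degree x)%:R <=
  r%:R * (D + (2 <= #|e :&: high D|)%N%:R * #|H|%:R).
Proof.
move=> D0 eH; rewrite natr_sum; set h := hub _ _ _.
apply: (@le_trans _ _ (\sum_(x in e :\ h)
    (D + (2 <= #|e :&: high D|)%N%:R * #|H|%:R))).
  apply: ler_sum => x; rewrite !inE => /andP[xh xe].
  have [xA|] := boolP (x \in high D); last first.
    rewrite inE -leNgt => xD.
    by rewrite (le_trans xD)// lerDl mulr_ge0 ?ler0n.
  rewrite (_ : (2 <= _)%N = true) ?mul1r; last first.
    rewrite (cardsD1 x) inE xe xA ltnS card_gt0; apply/set0Pn.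
    exists h; rewrite inE inE eq_sym xh inE hub_in//= /h /hub.
    case: (pickP [pred y | y \in e :&: high D]) => [y|/(_ x)] /=; first by rewrite inE => /andP[].
    by rewrite inE xe xA.
  apply: (@le_trans _ _ #|H|%:R); last by rewrite lerDr.
  rewrite ler_nat subset_leq_card//; apply/fintype.subsetP => f.
  by rewrite inE => /andP[].
rewrite sumr_const -[_ *+ _]mulr_natl ler_wpM2r ?ler_nat//.
  by rewrite addr_ge0 ?mulr_ge0 ?ler0n.
by rewrite -(Hr eH) subset_leq_card// finset.subsetDl.
Qed.

(** Each hyperedge with at least two vertices in [A] is classified by its trace
    on [A]. *)
Lemma card_bad_le A (tau : R) : 0 <= tau ->
  overlap R c H + p ^+ 2 * #|H|%:R <= tau ^+ 2 ->
  p * (\sum_(e in H) (2 <= #|e :&: A|))%:R <= (2 ^ #|A|)%:R * tau.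
Proof.
move=> tau0 le_tau.
have -> : (\sum_(e in H) (2 <= #|e :&: A|) =
    \sum_(S in powerset A) (2 <= #|S|) * #|[set e in H | e :&: A == S]|)%N.
  rewrite (partition_big (fun e => e :&: A) (fun S => S \in powerset A)) /=.
    apply: eq_bigr => S _.
    rewrite (eq_bigr (fun=> (2 <= #|S|)%N : nat)); last by move=> e /andP[_ /eqP->].
    rewrite sum_nat_const mulnC; congr (_ * _)%N.
    by apply: eq_card => e; rewrite [RHS]inE.
  by move=> e _; rewrite inE finset.subsetIr.
rewrite natr_sum mulr_sumr -card_powerset mulr_natl -sumr_const.
apply: ler_sum => S _; rewrite natrM.
case: ltnP => S2; last by rewrite mul0r mulr0.
rewrite mul1r -ler_sqr ?nnegrE ?mulr_ge0 ?ler0n ?(ltW p0)//.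
exact: le_trans (card_trace_le A S2) le_tau.
Qed.

(** The recoloring of [e] should move only vertices of small degree.  The
    vertices of degree above [eps / p] number at most [L], and keeping the color
    of one of them settles all hyperedges except those with two such vertices,
    which are rare by [card_bad_le]. *)
Lemma exists_hub (B eps tau : R) (L : nat) : H != finset.set0 ->
  0 < eps -> 0 <= tau ->
  #|H|%:R * p <= B -> r%:R * B <= L%:R * eps ->
  overlap R c H + p * B <= tau ^+ 2 ->
  exists2 u : {set V} -> V, (forall e, e \in H -> u e \in e) &
  \sum_(e in H) p * discrepancy (u e) e <=
    B * p + 2 * overlap R c H + 2 * r%:R * B * (eps + (2 ^ L)%:R * tau).
Proof.
move=> /set0Pn[e0 e0H] eps0 tau0 HB BL Htau.
have /set0Pn[x0 _] := uniform_neq0 r_ge2 Hr e0H.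
set D := eps / p; have D0 : 0 <= D by rewrite divr_ge0 ?ltW.
exists (hub x0 (high D)) => [e|]; first exact: hub_in.
apply: (le_trans (sum_discrepancy_le (@hub_in x0 (high D)))).
have HB2 : #|H|%:R * p ^+ 2 <= B * p by rewrite expr2 mulrA ler_wpM2r ?(ltW p0).
rewrite -!addrA; apply: lerD => //; rewrite lerD2l.
rewrite -[leLHS]mulrA -2![in leRHS]mulrA ler_wpM2l//.
have cardA : (#|high D| <= L)%N.
  rewrite -(ler_nat R) -(ler_pM2r eps0); apply: le_trans BL.
  have -> : #|high D|%:R * eps = #|high D|%:R * D * p.
    by rewrite mulrA divfK// gt_eqF.
  apply: (@le_trans _ _ ((r * #|H|)%:R * p)).
    by rewrite ler_wpM2r ?(ltW p0)// card_high_le.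
  by rewrite natrM -mulrA ler_wpM2l ?ler0n.
have bad : p * (\sum_(e in H) (2 <= #|e :&: high D|))%:R <= (2 ^ L)%:R * tau.
  apply: (le_trans (card_bad_le _ tau0 _)).
    apply: le_trans Htau; rewrite lerD2l expr2 -mulrA ler_wpM2l ?(ltW p0)//.
    by rewrite mulrC.
  by rewrite ler_wpM2r// ler_nat leq_exp2l.
apply: (@le_trans _ _ (p ^+ 2 * (\sum_(e in H)
    r%:R * (D + (2 <= #|e :&: high D|)%N%:R * #|H|%:R)))).
  rewrite ler_wpM2l ?sqr_ge0// natr_sum; apply: ler_sum => e eH.
  exact: hub_degree_le.
rewrite -mulr_sumr big_split /= sumr_const -mulr_suml -natr_sum.
rewrite -[D *+ _]mulr_natl.
set N := (\sum_(e in H) _)%:R in bad *.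
have -> : p ^+ 2 * (r%:R * (#|H|%:R * D + N * #|H|%:R)) =
    r%:R * ((#|H|%:R * p) * (D * p + p * N)) by ring.
have -> : D * p = eps by rewrite divfK// gt_eqF.
rewrite ler_wpM2l ?ler0n//; apply: ler_pM => //.
  by rewrite addr_ge0 ?mulr_ge0 ?ler0n ?(ltW p0) ?(ltW eps0).
by rewrite lerD2l.
Qed.

(** The error is made small by choosing [eps], then [L], then [tau], and only
    then letting [p] and the overlap tend to [0]. *)
Lemma stein_bound (B eps tau : R) (L k : nat) : 0 < eps -> 0 <= tau ->
  #|H|%:R * p <= B -> r%:R * B <= L%:R * eps ->
  overlap R c H + p * B <= tau ^+ 2 ->
  `| k%:R * pmf k - \sum_(e in H) (w e)%:R * p *
       avg (fun phi : {ffun V -> 'I_c} => (wcount phi + w e == k)%N%:R) | <=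
  K%:R * (B * p + 2 * overlap R c H + 2 * r%:R * B * (eps + (2 ^ L)%:R * tau)).
Proof.
move=> eps0 tau0 HB BL Htau.
(* A hub function needs a vertex, so the empty hypergraph is treated apart. *)
have [H0|Hn0] := eqVneq H finset.set0; last first.
  have [u uH le_u] := exists_hub Hn0 eps0 tau0 HB BL Htau.
  by apply: (le_trans (pmf_recursion k uH)); rewrite ler_wpM2l ?ler0n.
have B0 : 0 <= B by apply: le_trans HB; rewrite mulr_ge0 ?ler0n ?(ltW p0).
rewrite [X in _ - X]big1 => [|e]; last by rewrite H0 inE.
have -> : k%:R * pmf k = 0.
  rewrite -(avgZ k%:R (fun phi => (wcount phi == k)%:R)) -[RHS](avg_cst V c_gt0).
  apply: eq_avg => phi; rewrite /wcount big1 => [|e]; last by rewrite H0 inE.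
  by case: eqP => [<-|_]; rewrite ?mul0r ?mulr0.
rewrite subrr normr0 mulr_ge0 ?ler0n//.
by rewrite !addr_ge0 ?mulr_ge0 ?addr_ge0 ?mulr_ge0 ?ler0n ?overlap_ge0 ?(ltW p0) ?(ltW eps0).
Qed.

End SteinRecursion.
(** * Stability of the Panjer recursion *)

Section PanjerRecursion.
Variables (R : realType) (K : nat).
Implicit Types (lam : 'I_K -> R) (a b : nat -> R).
Local Open Scope classical_set_scope.

(** [shift_pmf b k j] is [b (k - (j + 1))], read as [0] at negative integers;
    the index [j] stands for the weight [j + 1]. *)
Definition shift_pmf b (k j : nat) : R := if (j < k)%N then b (k - j.+1)%N else 0.

Definition panjer lam b (k : nat) : R :=
  \sum_(i < K) i.+1%:R * lam i * shift_pmf b k i.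

Lemma cvg_sum (n : nat) (f : 'I_n -> nat -> R) (l : 'I_n -> R) :
  (forall i, f i m @[m --> \oo] --> l i) ->
  \sum_(i < n) f i m @[m --> \oo] --> \sum_(i < n) l i.
Proof.
by move=> fl; apply: cvg_big => //; exact: add_continuous.
Qed.

Lemma cvg0_mul_bounded (x y : nat -> R) :
  (\forall n \near \oo, 0 <= x n <= 1) ->
  y n @[n --> \oo] --> 0 -> x n * y n @[n --> \oo] --> 0.
Proof.
move=> hx hy; apply/cvgrPdist_le => e e0.
move/cvgrPdist_le: hy => /(_ e e0) hy.
near=> n; have /andP[x0 x1] : 0 <= x n <= 1 by near: n.
have : `|0 - y n| <= e by near: n.
rewrite !sub0r !normrN normrM (ger0_norm x0); apply: le_trans.
by rewrite ler_piMl.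
Unshelve. all: by end_near. Qed.

(** The recursion is linear and expresses each term by earlier ones.  After
    [a n] and [b] are scaled to agree at [0], their difference at [k] is a
    combination of the error terms and of the differences at smaller indices. *)
Lemma panjer_cvg0 (a : nat -> nat -> R) (lam_ : nat -> 'I_K -> R) lam b :
  (\forall n \near \oo, 0 <= a n 0%N <= 1) ->
  (forall k, k%:R * a n k - panjer (lam_ n) (a n) k @[n --> \oo] --> 0) ->
  (forall i, lam_ n i @[n --> \oo] --> lam i) ->
  (forall k, k%:R * b k = panjer lam b k) ->
  forall k, b 0%N * a n k - a n 0%N * b k @[n --> \oo] --> 0.
Proof.
move=> a01 ha hlam hb; elim/ltn_ind => -[_|k IH].
  under eq_fun do rewrite mulrC subrr; exact: cvg_cst.
have -> : (fun n => b 0%N * a n k.+1 - a n 0%N * b k.+1) = (fun n =>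
    k.+1%:R^-1 * (b 0%N * (k.+1%:R * a n k.+1 - panjer (lam_ n) (a n) k.+1) +
    \sum_(i < K) i.+1%:R * (lam_ n i *
        (b 0%N * shift_pmf (a n) k.+1 i - a n 0%N * shift_pmf b k.+1 i) +
      a n 0%N * (shift_pmf b k.+1 i * (lam_ n i - lam i))))).
  apply/funext => n.
  have -> : \sum_(i < K) i.+1%:R * (lam_ n i *
        (b 0%N * shift_pmf (a n) k.+1 i - a n 0%N * shift_pmf b k.+1 i) +
      a n 0%N * (shift_pmf b k.+1 i * (lam_ n i - lam i))) =
      b 0%N * panjer (lam_ n) (a n) k.+1 - a n 0%N * panjer lam b k.+1.
    by rewrite /panjer !mulr_sumr -sumrB; apply: eq_bigr => i _; ring.
  rewrite -hb; set P := panjer _ _ _; have k0 : k.+1%:R != 0 :> R by [].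
  by field.
rewrite [X in _ --> X](_ : 0 = k.+1%:R^-1 * (b 0%N * 0 + \sum_(i < K) 0)); last first.
  by rewrite big1 ?mulr0 ?addr0 ?mulr0.
apply: cvgMl_tmp; apply: cvgD; first exact: cvgMl_tmp.
apply: cvg_sum => i.
rewrite [X in _ --> X](_ : 0 = i.+1%:R * (lam i * 0 + 0)); last by rewrite mulr0 addr0 mulr0.
apply: cvgMl_tmp; apply: cvgD; last first.
  apply: cvg0_mul_bounded => //.
  rewrite [X in _ --> X](_ : 0 = shift_pmf b k.+1 i * 0); last by rewrite mulr0.
  by apply: cvgMl_tmp; apply/subr_cvg0.
apply: cvgM => //; rewrite /shift_pmf; case: ifP => ik; first by apply: IH; lia.
by under eq_fun do rewrite !mulr0 subrr; exact: cvg_cst.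
Qed.

(** The recursion determines the limit law up to the value at [0], and this
    value is forced by the absence of escape of mass. *)
Lemma panjer_pmf_cvg (a : nat -> nat -> R) (lam_ : nat -> 'I_K -> R) lam b :
  (\forall n \near \oo, forall k, 0 <= a n k) ->
  (forall eps, 0 < eps -> \forall M \near \oo, \forall n \near \oo,
     1 - eps <= \sum_(k < M) a n k <= 1) ->
  (forall k, k%:R * a n k - panjer (lam_ n) (a n) k @[n --> \oo] --> 0) ->
  (forall i, lam_ n i @[n --> \oo] --> lam i) ->
  0 < b 0%N <= 1 ->
  (forall eps, 0 < eps -> \forall M \near \oo, 1 - eps <= \sum_(k < M) b k <= 1) ->
  (forall k, k%:R * b k = panjer lam b k) ->
  forall k, a n k @[n --> \oo] --> b k.
Proof.
move=> a0 amass ha hlam /andP[b0 b1] bmass hb.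
have a01 : \forall n \near \oo, 0 <= a n 0%N <= 1.
  have [M [M0 hM]] : exists M, (0 < M)%N /\ \forall n \near \oo,
      1 - 1 <= \sum_(k < M) a n k <= 1.
    near \oo => M; exists M; split; first by near: M; exists 1%N.
    by near: M; apply: amass.
  near=> n; have an : forall k, 0 <= a n k by near: n.
  rewrite an /=; have /andP[_] : 1 - 1 <= \sum_(k < M) a n k <= 1 by near: n.
  apply: le_trans; case: (M) M0 => // M' _.
  by rewrite big_ord_recl lerDl sumr_ge0.
have ratio := panjer_cvg0 a01 ha hlam hb.
have cvg0 : a n 0%N @[n --> \oo] --> b 0%N.
  apply/cvgrPdist_le => eps eps0; have e3 : 0 < eps / 3 by rewrite divr_gt0.
  near \oo => M.
  have /andP[bM1 bM2] : 1 - eps / 3 <= \sum_(k < M) b k <= 1.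
    by near: M; apply: bmass.
  have aM : \forall n \near \oo, 1 - eps / 3 <= \sum_(k < M) a n k <= 1.
    by near: M; apply: amass.
  have : b 0%N * (\sum_(k < M) a n k) - a n 0%N * (\sum_(k < M) b k)
      @[n --> \oo] --> 0.
    rewrite [X in _ --> X](_ : 0 = \sum_(k < M) 0); last by rewrite big1.
    have -> : (fun n => b 0%N * (\sum_(k < M) a n k) - a n 0%N * (\sum_(k < M) b k))
      = (fun n => \sum_(k < M) (b 0%N * a n k - a n 0%N * b k)).
      by apply/funext => n; rewrite sumrB !mulr_sumr.
    by apply: cvg_sum => k; apply: ratio.
  move=> /cvgrPdist_le/(_ _ e3) hM.
  near=> n; have /andP[an0 an1] : 0 <= a n 0%N <= 1 by near: n.
  have /andP[aM1 aM2] : 1 - eps / 3 <= \sum_(k < M) a n k <= 1 by near: n.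
  have : `|0 - (b 0%N * (\sum_(k < M) a n k) - a n 0%N * (\sum_(k < M) b k))| <= eps / 3.
    by near: n.
  rewrite sub0r normrN; set A := \sum_(_ < _) a _ _ in aM1 aM2 *.
  set B := \sum_(_ < _) b _ in bM1 bM2 *.
  have hb0 : 0 <= b 0%N * (1 - A) <= eps / 3.
    apply/andP; split; first by rewrite mulr_ge0 ?(ltW b0) ?subr_ge0.
    by apply: (@le_trans _ _ (1 - A)); [rewrite ler_piMl ?subr_ge0|lra].
  have ha0 : 0 <= a n 0%N * (1 - B) <= eps / 3.
    apply/andP; split; first by rewrite mulr_ge0// subr_ge0.
    by apply: (@le_trans _ _ (1 - B)); [rewrite ler_piMl ?subr_ge0|lra].
  move: hb0 ha0; rewrite !mulrBr !mulr1 !ler_norml => /andP[? ?] /andP[? ?] /andP[? ?].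
  lra.
move=> k.
have -> : (fun n => a n k) = (fun n => (b 0%N)^-1 *
    ((b 0%N * a n k - a n 0%N * b k) + a n 0%N * b k)).
  by apply/funext => n; field; rewrite gt_eqF.
rewrite [X in _ --> X](_ : _ = (b 0%N)^-1 * (0 + b 0%N * b k)); last first.
  by field; rewrite gt_eqF.
by apply: cvgMl_tmp; apply: cvgD => //; apply: cvgMr_tmp.
Unshelve. all: by end_near. Qed.

End PanjerRecursion.
(** * Asymptotics of the weighted count *)

Section PmfFacts.
Variables (R : realType) (V : finType) (c r K : nat).
Variables (H : hypergraph V) (w : {set V} -> nat).
Local Notation q := (c%:R^-1 : R).
Local Notation p := (q ^+ r.-1).
Local Notation pmf := (@pmf R V c H w).
Local Notation wcount := (@wcount V c H w).
Hypotheses (r_ge2 : (2 <= r)%N) (c_gt0 : (0 < c)%N).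
Hypotheses (Hr : is_uniform r H) (wK : forall e, e \in H -> (1 <= w e <= K)%N).

Lemma pmf_ge0 k : 0 <= pmf k.
Proof. by apply: avg_ge0 => phi; rewrite ler0n. Qed.

Lemma sum_pmf M : \sum_(k < M) pmf k = avg (fun phi => (wcount phi < M)%N%:R).
Proof.
rewrite /pmf -avg_sum; apply: eq_avg => phi.
case: ltnP => hM; last first.
  rewrite big1// => k _; case: eqP => // h.
  by have := ltn_ord k; rewrite -h ltnNge hM.
rewrite (bigD1 (Ordinal hM))//= eqxx big1 ?addr0// => k kh.
by case: eqP => // h; case/eqP: kh; apply: val_inj.
Qed.

Lemma sum_pmf_le1 M : \sum_(k < M) pmf k <= 1.
Proof.
by rewrite sum_pmf -[leRHS](avg_cst V c_gt0); apply: ler_avg => phi; rewrite lern1 leq_b1.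
Qed.

(** Markov's inequality. *)
Lemma sum_pmf_ge M : (0 < M)%N ->
  1 - K%:R * (#|H|%:R * p) / M%:R <= \sum_(k < M) pmf k.
Proof.
move=> M0; rewrite sum_pmf.
apply: (@le_trans _ _ (avg (fun phi : {ffun V -> 'I_c} =>
    1 + (- M%:R^-1) * (K%:R * count R H phi)))).
  rewrite avgD avg_cst// (avgZ _ (fun phi => K%:R * count R H phi)).
  rewrite (avgZ K%:R (count R H)) (avg_count R r_ge2 c_gt0 Hr) mulNr lerD2l lerN2.
  by rewrite mulrC.
apply: ler_avg => phi.
have WK : (wcount phi)%:R <= K%:R * count R H phi.
  rewrite /wcount natr_sum mulr_sumr; apply: ler_sum => e eH.
  by rewrite natrM ler_wpM2r ?ler0n// ler_nat; case/andP: (wK eH).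
have M0' : 0 < M%:R :> R by rewrite ltr0n.
case: ltnP => hM.
  by rewrite mulNr gerDl oppr_le0 mulr_ge0 ?invr_ge0 ?ler0n// (le_trans _ WK)// ler0n.
rewrite mulNr subr_le0 mulrC ler_pdivlMr// mul1r.
by apply: le_trans WK; rewrite ler_nat.
Qed.

Lemma panjer_pmfE k :
  \sum_(e in H) (w e)%:R * p *
     avg (fun phi : {ffun V -> 'I_c} => (wcount phi + w e == k)%N%:R) =
  panjer (fun i : 'I_K => #|weight_class H w i.+1|%:R * p) pmf k.
Proof.
rewrite (sum_weight_class _ wK) /panjer; apply: eq_bigr => i _.
transitivity (\sum_(e in weight_class H w i.+1) i.+1%:R * p * shift_pmf pmf k i).
  apply: eq_bigr => e; rewrite inE => /andP[_ /eqP ->]; congr (_ * _).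
  rewrite /shift_pmf; case: ltnP => ik.
    by apply: eq_avg => phi; rewrite -[in RHS](eqn_add2r i.+1) subnK.
  rewrite -[RHS](avg_cst V c_gt0); apply: eq_avg => phi.
  by rewrite gtn_eqF// addnS ltnS (leq_trans ik) ?leq_addl.
by rewrite sumr_const -[LHS]mulr_natl; ring.
Qed.

End PmfFacts.

Section Asymptotics.
Variables (R : realType) (r K : nat).
Variables (V : nat -> finType) (H : forall n, hypergraph (V n)).
Variables (w : forall n, {set V n} -> nat) (c : nat -> nat).
Arguments w : clear implicits.
Variable lambda : 'I_K -> R.
Local Open Scope classical_set_scope.
Local Notation q n := ((c n)%:R^-1 : R).
Local Notation p n := (q n ^+ r.-1).
Local Notation Hi n i := (weight_class (H n) (w n) i.+1).
Local Notation T n i := (count R (Hi n i) : {ffun V n -> 'I_(c n)} -> R).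
Hypotheses (r_ge2 : (2 <= r)%N) (Hr : forall n, is_uniform r (H n)).
Hypothesis wK : forall n e, e \in H n -> (1 <= w n e <= K)%N.
Hypothesis c_oo : c n @[n --> \oo] --> \oo.
Hypothesis mean_cvg : forall i : 'I_K, avg (T n i) @[n --> \oo] --> lambda i.
Hypothesis var_cvg : forall i : 'I_K,
  avg (fun phi => (T n i phi - avg (T n i)) ^+ 2) @[n --> \oo] --> lambda i.

Lemma near_ge2 : \forall n \near \oo, (2 <= c n)%N.
Proof. by have /cvgnyPge/(_ 2%N) := c_oo. Qed.

Lemma q_cvg0 : q n @[n --> \oo] --> 0.
Proof.
have /(cvg_comp _ _ c_oo) : (k%:R^-1 : R) @[k --> \oo] --> 0; last exact.
rewrite -(cvg_shiftS (fun k => k%:R^-1 : R)); exact: cvg_harmonic.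
Qed.

Lemma near_p_le_q : \forall n \near \oo, 0 <= p n <= q n.
Proof.
near=> n; have c2 : (2 <= c n)%N by near: n; exact: near_ge2.
have c0 : (0 < c n)%N by apply: leq_trans c2.
rewrite exprn_ge0 ?(ltW (q_gt0 R c0))//= -[leRHS]expr1; apply: ler_qX => //.
by rewrite -ltnS prednK// ltnW.
Unshelve. all: by end_near. Qed.

Lemma p_cvg0 : p n @[n --> \oo] --> 0.
Proof.
apply: (squeeze_cvgr near_p_le_q); [exact: cvg_cst|exact: q_cvg0].
Qed.

Lemma class_mean_cvg (i : 'I_K) : #|Hi n i|%:R * p n @[n --> \oo] --> lambda i.
Proof.
have := @mean_cvg i; apply: cvg_trans; apply: near_eq_cvg; near=> n.
have c2 : (2 <= c n)%N by near: n; exact: near_ge2.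
have c0 : (0 < c n)%N by apply: leq_trans c2.
by rewrite (avg_count R r_ge2 c0)//; apply: uniform_weight_class.
Unshelve. all: by end_near. Qed.

Lemma class_overlap_cvg0 (i : 'I_K) : overlap R (c n) (Hi n i) @[n --> \oo] --> 0.
Proof.
apply: (@squeeze_cvgr _ _ _ _ (fun=> 0) (fun n => 2 *
  (avg (fun phi => (T n i phi - avg (T n i)) ^+ 2) - avg (T n i)
   + avg (T n i) * p n))).
- near=> n; have c2 : (2 <= c n)%N by near: n; exact: near_ge2.
  have c0 : (0 < c n)%N by apply: leq_trans c2.
  rewrite overlap_ge0//= overlap_le_variance//; exact: uniform_weight_class.
- exact: cvg_cst.
rewrite [X in _ --> X](_ : 0 = 2 * (lambda i - lambda i + lambda i * 0)); last first.
  by rewrite mulr0 addr0 subrr mulr0.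
apply: cvgMl_tmp; apply: cvgD; first exact: cvgB.
by apply: cvgM => //; exact: p_cvg0.
Unshelve. all: by end_near. Qed.

Lemma overlap_cvg0 : overlap R (c n) (H n) @[n --> \oo] --> 0.
Proof.
apply: (@squeeze_cvgr _ _ _ _ (fun=> 0) (fun n => (K * 2 ^ r)%:R *
  \sum_(i < K) (overlap R (c n) (Hi n i) + (#|Hi n i|%:R * p n) * q n))).
- near=> n; have c2 : (2 <= c n)%N by near: n; exact: near_ge2.
  have c0 : (0 < c n)%N by apply: leq_trans c2.
  rewrite overlap_ge0//=; have := overlap_weight_classes R r_ge2 c0 (@Hr n) (@wK n).
  congr (_ <= _ * _); apply: eq_bigr => i _; congr (_ + _).
  by rewrite -mulrA -exprSr prednK// ltnW.
- exact: cvg_cst.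
rewrite [X in _ --> X](_ : 0 = (K * 2 ^ r)%:R * \sum_(i < K) (0 + lambda i * 0)); last first.
  by rewrite big1 ?mulr0// => i _; rewrite mulr0 addr0.
apply: cvgMl_tmp; apply: cvg_sum => i; apply: cvgD; first exact: class_overlap_cvg0.
by apply: cvgM; [exact: class_mean_cvg|exact: q_cvg0].
Unshelve. all: by end_near. Qed.

Lemma mean_cvg_total :
  #|H n|%:R * p n @[n --> \oo] --> \sum_(i < K) lambda i.
Proof.
rewrite (_ : (fun n => _) = (fun n => \sum_(i < K) #|Hi n i|%:R * p n)).
  by apply: cvg_sum => i; exact: class_mean_cvg.
apply/funext => n; rewrite -mulr_suml; congr (_ * _).
have := sum_weight_class (fun=> 1 : R) (@wK n).
by rewrite sumr_const => ->; apply: eq_bigr => i _; rewrite sumr_const.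
Qed.

Lemma pmf_panjer_cvg0 k :
  k%:R * @pmf R (V n) (c n) (H n) (w n) k - panjer (fun i : 'I_K => #|Hi n i|%:R * p n)
     (@pmf R (V n) (c n) (H n) (w n)) k @[n --> \oo] --> 0.
Proof.
apply/cvgrPdist_le => e e0.
set B := \sum_(i < K) lambda i + 1.
have HB : \forall n \near \oo, #|H n|%:R * p n <= B.
  have /cvgrPdist_le/(_ 1 ltr01) := mean_cvg_total; apply: filterS => n.
  by rewrite /B ler_norml => /andP[]; lra.
have B0 : 0 <= B.
  near \oo => n; have /andP[pn0 _] : 0 <= p n <= q n.
    by near: n; exact: near_p_le_q.
  have : #|H n|%:R * p n <= B by near: n.
  by apply: le_trans; rewrite mulr_ge0.
(* With these choices K times the last term of stein_bound is at most e / 2. *)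
pose G := 1 + 2 * K%:R * r%:R * B.
have G0 : 0 < G by rewrite ltr_wpDr// !mulr_ge0.
pose eps := e / (4 * G); have eps0 : 0 < eps by rewrite divr_gt0// mulr_gt0.
pose L := Num.bound (r%:R * B / eps).
have BL : r%:R * B <= L%:R * eps.
  have /archi_boundP/ltW : 0 <= r%:R * B / eps.
    by rewrite divr_ge0 ?(ltW eps0)// mulr_ge0.
  by rewrite ler_pdivrMr.
pose tau := eps / (2 ^ L)%:R.
have L0 : 0 < (2 ^ L)%:R :> R by rewrite ltr0n expn_gt0.
have tau0 : 0 < tau by rewrite divr_gt0.
have small1 : \forall n \near \oo, overlap R (c n) (H n) + p n * B <= tau ^+ 2.
  have : overlap R (c n) (H n) + p n * B @[n --> \oo] --> 0 + 0 * B.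
    by apply: cvgD; [exact: overlap_cvg0|apply: cvgMr_tmp; exact: p_cvg0].
  rewrite mul0r addr0 => /cvgrPdist_le/(_ (tau ^+ 2)); rewrite exprn_gt0// => /(_ isT).
  by apply: filterS => n; rewrite sub0r normrN => /ler_normlW.
have small2 : \forall n \near \oo,
    K%:R * (B * p n + 2 * overlap R (c n) (H n)) <= e / 2.
  have : K%:R * (B * p n + 2 * overlap R (c n) (H n)) @[n --> \oo] -->
      K%:R * (B * 0 + 2 * 0).
    apply: cvgMl_tmp; apply: cvgD; apply: cvgMl_tmp; [exact: p_cvg0|exact: overlap_cvg0].
  rewrite !mulr0 addr0 mulr0 => /cvgrPdist_le/(_ (e / 2)); rewrite divr_gt0// => /(_ isT).
  by apply: filterS => n; rewrite sub0r normrN => /ler_normlW.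
near=> n; have c2 : (2 <= c n)%N by near: n; exact: near_ge2.
have c0 : (0 < c n)%N by apply: leq_trans c2.
rewrite sub0r normrN -(panjer_pmfE R r c0 (@wK n)).
have wK' f : f \in H n -> (w n f <= K)%N by move=> /wK/andP[].
have h1 : #|H n|%:R * p n <= B by near: n.
have h2 : overlap R (c n) (H n) + p n * B <= tau ^+ 2 by near: n.
apply: (le_trans (stein_bound r_ge2 c0 (@Hr n) wK' k eps0 (ltW tau0) h1 BL h2)).
rewrite mulrDr [leRHS](splitr e) lerD//; first by near: n.
have -> : (2 ^ L)%:R * tau = eps by rewrite mulrC divfK// gt_eqF.
have -> : e / 2 = G * (eps + eps) by rewrite /eps; field; rewrite gt_eqF.
rewrite mulrA ler_wpM2r ?addr_ge0 ?(ltW eps0)// /G.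
have -> : K%:R * (2 * r%:R * B) = 2 * K%:R * r%:R * B by ring.
by rewrite lerDr.
Unshelve. all: by end_near. Qed.

Lemma pmf_mass (eps : R) : 0 < eps -> \forall M \near \oo, \forall n \near \oo,
  1 - eps <= \sum_(k < M) @pmf R (V n) (c n) (H n) (w n) k <= 1.
Proof.
move=> eps0; set B := \sum_(i < K) lambda i + 1.
have HB : \forall n \near \oo, #|H n|%:R * p n <= B.
  have /cvgrPdist_le/(_ 1 ltr01) := mean_cvg_total; apply: filterS => n.
  by rewrite /B ler_norml => /andP[]; lra.
have B0 : 0 <= B.
  near \oo => n; have /andP[pn0 _] : 0 <= p n <= q n.
    by near: n; exact: near_p_le_q.
  have : #|H n|%:R * p n <= B by near: n.
  by apply: le_trans; rewrite mulr_ge0.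
exists (Num.bound (K%:R * B / eps)).+1 => // M /= hM.
have M0 : (0 < M)%N by apply: leq_trans hM.
near=> n; have c2 : (2 <= c n)%N by near: n; exact: near_ge2.
have c0 : (0 < c n)%N by apply: leq_trans c2.
rewrite sum_pmf_le1// andbT.
apply: le_trans (sum_pmf_ge R r_ge2 c0 (@Hr n) (@wK n) M0).
rewrite lerD2l lerN2 ler_pdivrMr ?ltr0n//.
apply: (@le_trans _ _ (K%:R * B)); first by rewrite ler_wpM2l//; near: n.
have /archi_boundP/ltW : 0 <= K%:R * B / eps.
  by rewrite divr_ge0 ?(ltW eps0)// mulr_ge0.
rewrite ler_pdivrMr// => /le_trans -> //.
by rewrite mulrC ler_wpM2l ?(ltW eps0)// ler_nat ltnW.
Unshelve. all: by end_near. Qed.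
End Asymptotics.
(** * From random variables to the finite space of colorings *)

Section FiniteAdditivity.
Local Open Scope classical_set_scope.
Context d (T : measurableType d) (R : realType) (P : probability T R).

Lemma probability_fin_bigcup (I : finType) (A : I -> set T) :
  (forall i, measurable (A i)) -> (forall i j t, A i t -> A j t -> i = j) ->
  P (\bigcup_i A i) = (\sum_i P (A i))%E.
Proof.
move=> mA Adisj; rewrite measure_fin_bigcup//.
- rewrite (@fsbigE _ _ _ _ _ (index_enum I)) ?index_enum_uniq//.
    by apply: eq_bigl => i; rewrite in_setT.
  by move=> i _; rewrite mem_index_enum.
- exact: finite_finset.
- by move=> i j _ _ [t [Ai Aj]]; exact: Adisj Ai Aj.
Qed.

End FiniteAdditivity.

Section Transfer.
Local Open Scope classical_set_scope.
Context d (T : measurableType d) (R : realType) (P : probability T R).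
Variables (V : finType) (c : nat) (X : V -> {RV P >-> nat}).
Hypotheses (c_gt0 : (0 < c)%N) (hX : random_coloring P c X).
Local Notation coloring := {ffun V -> 'I_c}.
Implicit Types (phi : coloring).

Definition cylinder phi : set T := [set t | forall v, X v t = (phi v).+1].

Lemma cylinderE phi : cylinder phi =
  \bigcap_(v in [set v | v \in [set: V]%SET]) (X v @^-1` [set (phi v).+1]).
Proof. by apply/seteqP; split=> t h v; [move=> _|]; apply: h; rewrite /= ?inE. Qed.

Lemma measurable_cylinder phi : measurable (cylinder phi).
Proof.
rewrite cylinderE; apply: fin_bigcap_measurable => [|v _]; first exact: finite_finset.
exact: measurable_funPTI.
Qed.

Lemma cylinder_inj phi psi t : cylinder phi t -> cylinder psi t -> phi = psi.
Proof.
move=> h1 h2; apply/ffunP => v; apply: val_inj => /=.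
by apply: succn_inj; rewrite -h1 -h2.
Qed.

Lemma probability_cylinder phi : P (cylinder phi) = (#|{: coloring}|%:R^-1)%:E.
Proof.
have [unif indep] := hX; rewrite cylinderE indep//.
rewrite (eq_bigr (fun=> (c%:R^-1)%:E)) => [|v _]; last first.
  have := unif v (phi v).+1; rewrite /distribution /pushforward => ->.
  by rewrite ltn_ord.
rewrite prodEFin big_const iter_mulr_1 card_ffun card_ord natrX exprVn.
by rewrite cardsE.
Qed.

Lemma probability_cylinders : P (\bigcup_phi cylinder phi) = 1%E.
Proof.
rewrite probability_fin_bigcup; [|exact: measurable_cylinder|exact: cylinder_inj].
rewrite (eq_bigr (fun=> (#|{: coloring}|%:R^-1)%:E)) => [|phi _]; last first.
  exact: probability_cylinder.
rewrite sumEFin sumr_const -[_ *+ _]mulr_natl mulfV//.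
by rewrite pnatr_eq0 card_ffun card_ord -lt0n expn_gt0 c_gt0.
Qed.

(** Almost surely [X] is one of the colorings [phi], each of them with the same
    probability. *)
Lemma expectation_coloring (F : T -> R) (G : coloring -> R) :
  measurable_fun setT F -> (forall t, 0 <= F t) -> (forall phi, 0 <= G phi) ->
  (forall phi t, cylinder phi t -> F t = G phi) ->
  'E_P[F]%E = (avg G)%:E.
Proof.
move=> mF F0 G0 FG.
pose gi phi t : \bar R := ((G phi)%:E * (\1_(cylinder phi) t)%:E)%E.
pose g t : \bar R := (\sum_phi gi phi t)%E.
have mg phi : measurable_fun setT (gi phi).
  rewrite (_ : gi phi = EFin \o (fun t => G phi * \1_(cylinder phi) t))//.
  apply/measurable_EFinP; apply: measurable_funM => //.
  by apply: measurable_indic; exact: measurable_cylinder.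
have g0 phi t : setT t -> (0 <= gi phi t)%E.
  by move=> _; rewrite lee_fin mulr_ge0.
rewrite unlock (@ge0_ae_eq_integral _ _ _ _ _ _ g)//.
- rewrite ge0_integral_sum// /avg mulr_suml -sumEFin; apply: eq_bigr => phi _.
  rewrite ge0_integralZl_EFin//; last first.
    apply/measurable_EFinP; apply: measurable_indic; exact: measurable_cylinder.
  rewrite integral_indic//; last exact: measurable_cylinder.
  by rewrite EFinM setIT; congr (_ * _)%E; exact: probability_cylinder.
- exact/measurable_EFinP.
- by apply: emeasurable_sum.
- by move=> t _; rewrite lee_fin.
- by move=> t _; apply: sume_ge0 => phi _; apply: g0.
have mU : measurable (\bigcup_phi cylinder phi).
  apply: fin_bigcup_measurable => [|phi _]; first exact: finite_finset.
  exact: measurable_cylinder.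
have PU : P (~` (\bigcup_phi cylinder phi)) = 0%E.
  by rewrite probability_setC// probability_cylinders subee.
exists (~` (\bigcup_phi cylinder phi)); split; [exact: measurableC|exact: PU|].
move=> t /=; apply: contra_not; rewrite /= => -[phi _ hphi] _.
rewrite /g (bigD1 phi)//= /gi indicE mem_set// mule1 big1 ?adde0 ?(FG _ _ hphi)//.
move=> psi psi_phi; rewrite indicE memNset ?mule0// => hpsi.
by move/eqP: psi_phi; apply; exact: cylinder_inj hpsi hphi.
Qed.

Lemma probability_coloring (A : set T) (Phi : pred coloring) :
  measurable A -> (forall phi t, cylinder phi t -> A t <-> Phi phi) ->
  P A = (avg (fun phi => (Phi phi)%:R))%:E.
Proof.
move=> mA hA; transitivity ('E_P[\1_A])%E.
  by rewrite unlock integral_indic// setIT.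
apply: expectation_coloring => //.
move=> phi t /hA; rewrite indicE => h; congr (nat_of_bool _)%:R.
by apply/idP/idP => [|hp]; rewrite in_setE; [move/h|apply/h].
Qed.

Lemma mono_fmono e phi t : cylinder phi t -> mono X e t <-> fmono e phi.
Proof.
move=> h; split=> [m|/fmonoP m v v' ve v'e]; last by rewrite !h (m v v').
apply/fmonoP => v v' ve v'e; apply: val_inj; apply: succn_inj => /=.
by rewrite -!h; apply: m.
Qed.

Lemma indic_mono e phi t : cylinder phi t -> \1_(mono X e) t = (fmono e phi)%:R :> R.
Proof.
move=> /mono_fmono h; rewrite indicE; congr (nat_of_bool _)%:R.
by apply/idP/idP => [|hp]; rewrite in_setE; [move/h|apply/h].
Qed.

Lemma measurable_mono_count (H : hypergraph V) :
  measurable_fun setT (mono_count X H : T -> R).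
Proof.
rewrite /mono_count; under eq_fun do rewrite -big_filter.
apply: measurable_sum => e; apply: measurable_indic; exact: measurable_mono.
Qed.

Lemma mono_count_cylinder (H : hypergraph V) phi t :
  cylinder phi t -> mono_count X H t = count R H phi.
Proof. by move=> h; apply: eq_bigr => e _; apply: indic_mono. Qed.

Lemma expectation_mono_count (H : hypergraph V) :
  'E_P[mono_count X H]%E = (avg (count R H : coloring -> R))%:E.
Proof.
apply: expectation_coloring => //.
- exact: measurable_mono_count.
- by move=> t; apply: sumr_ge0.
- by move=> phi; apply: sumr_ge0.
- by move=> phi t; apply: mono_count_cylinder.
Qed.

Lemma variance_mono_count (H : hypergraph V) : 'V_P[mono_count X H]%E =
  (avg (fun phi : coloring => (count R H phi - avg (count R H : coloring -> R)) ^+ 2))%:E.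
Proof.
rewrite /variance unlock expectation_mono_count /=; apply: expectation_coloring.
- apply: measurable_funM; apply: measurable_funB => //; exact: measurable_mono_count.
- by move=> t; rewrite /= -expr2 sqr_ge0.
- by move=> phi; rewrite sqr_ge0.
- by move=> phi t /(mono_count_cylinder H) /= <-; rewrite -expr2.
Qed.

Lemma cdf_weighted_mono_count (H : hypergraph V) (w : {set V} -> nat) (M : nat) (x : R) :
  (forall k : nat, k%:R <= x <-> (k < M)%N) ->
  cdf (weighted_mono_count X H w : {RV P >-> R}) x =
  (\sum_(k < M) @pmf R V c H w k)%:E.
Proof.
move=> hM; rewrite sum_pmf /cdf /distribution /pushforward.
apply: probability_coloring => [|phi t h]; first exact: measurable_funPTI.
rewrite /= in_itv /= -[X in _ <-> X]hM (_ : weighted_mono_count X H w t =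
  (wcount H w phi)%:R) //.
rewrite /weighted_mono_count /wcount natr_sum; apply: eq_bigr => e _.
by rewrite natrM (indic_mono e h).
Qed.

End Transfer.
(** * The compound Poisson law *)

Section CompoundPoisson.
Local Open Scope classical_set_scope.
Context d (T : measurableType d) (R : realType) (Q : probability T R).
Variables (K : nat) (Z : 'I_K -> {RV Q >-> nat}) (lambda : 'I_K -> R).
Hypothesis lambda_ge0 : forall i, 0 <= lambda i.
Hypothesis Z_poisson : forall i, poisson_law Q (lambda i) (Z i).
Hypothesis Z_indep : mutually_independent Q Z.

(** For [l = 0] this is the point mass at [0], because [0 ^+ 0 = 1]; a single
    formula covers all rates. *)
Definition pois (l : R) (m : nat) : R := l ^+ m / m`!%:R * expR (- l).

Lemma poisS l m : m.+1%:R * pois l m.+1 = l * pois l m.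
Proof.
have m0 : m`!%:R != 0 :> R by rewrite pnatr_eq0 -lt0n fact_gt0.
rewrite /pois factS natrM exprS; field; by rewrite m0 addrC natr1 pnatr_eq0.
Qed.

Lemma poisson_law_pois i m : Q (Z i @^-1` [set m]) = (pois (lambda i) m)%:E.
Proof.
have := Z_poisson i [set m]; rewrite /distribution /pushforward => ->.
rewrite /poisson_prob; case: ltgtP (lambda_ge0 i) => // [l0|<-] _.
  by rewrite esum_set1 ?lee_fin ?poisson_pmf_ge0// /poisson_pmf l0.
rewrite diracE /pois oppr0 expR0 mulr1 expr0n.
case: m => [|m]; first by rewrite mem_set//= divr1.
by rewrite memNset//= mul0r.
Qed.

Definition csum (t : T) : nat := \sum_(i < K) i.+1 * Z i t.

Lemma csumE t : compound_sum Z t = (csum t)%:R :> R.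
Proof. by rewrite natr_sum; apply: eq_bigr => i _; rewrite natrM. Qed.

Definition cpmf (k : nat) : R := fine (Q [set t | csum t = k]).

Lemma measurable_csum (A : set nat) : measurable (csum @^-1` A).
Proof.
have -> : csum @^-1` A = \bigcup_(k in A) (compound_sum Z @^-1` [set k%:R : R]).
  apply/seteqP; split=> t /= => [At|[k Ak /eqP]].
    by exists (csum t) => //=; rewrite csumE.
  by rewrite csumE eqr_nat => /eqP ->.
by apply: bigcup_measurable => k _; exact: measurable_funPTI.
Qed.

Lemma cpmfE k : (cpmf k)%:E = Q [set t | csum t = k].
Proof. by rewrite fineK// fin_num_measure//; exact: (measurable_csum [set k]). Qed.

Lemma cpmf_sum M : (\sum_(k < M) cpmf k)%:E = Q [set t | (csum t < M)%N].
Proof.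
rewrite -sumEFin (eq_bigr (fun k : 'I_M => Q [set t | csum t = k])) => [|k _]; last exact: cpmfE.
rewrite -(@probability_fin_bigcup _ _ _ _ 'I_M (fun k => [set t | csum t = k])).
- congr (Q _); apply/seteqP; split=> t /=; first by move=> [k _ /= ->].
  by move=> tM; exists (Ordinal tM).
- by move=> k; exact: (measurable_csum [set nat_of_ord k]).
- by move=> i j t /= -> ij; apply: val_inj.
Qed.

Lemma cpmf_mass (eps : R) : 0 < eps ->
  \forall M \near \oo, 1 - eps <= \sum_(k < M) cpmf k <= 1.
Proof.
move=> eps0.
have cvg1 : Q [set t | (csum t < M)%N] @[M --> \oo] --> 1%E.
  have <- : Q (\bigcup_M [set t | (csum t < M)%N]) = 1%E.
    rewrite -(@probability_setT _ _ _ Q); congr (Q _); apply/seteqP; split=> // t _.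
    by exists (csum t).+1 => //=.
  apply: nondecreasing_cvg_mu.
  - by move=> M; exact: (measurable_csum [set m | (m < M)%N]).
  - by apply: bigcup_measurable => M _; exact: (measurable_csum [set m | (m < M)%N]).
  - by move=> m n mn; apply/subsetPset => t /= /leq_trans; apply.
have : \sum_(k < M) cpmf k @[M --> \oo] --> (1 : R).
  rewrite (_ : (fun M => _) = fine \o (fun M => Q [set t | (csum t < M)%N])).
    exact: fine_cvg cvg1.
  by apply/funext => M; rewrite /= -cpmf_sum.
move=> /cvgrPdist_le/(_ _ eps0); apply: filterS => M.
have : \sum_(k < M) cpmf k <= 1.
  by rewrite -lee_fin cpmf_sum probability_le1//; exact: (measurable_csum [set m | (m < M)%N]).
by move=> ->; rewrite ler_norml andbT => /andP[]; lra.
Qed.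

Definition isum N (z : {ffun 'I_K -> 'I_N}) : nat := \sum_(i < K) i.+1 * z i.

(** For [N > k] the truncation of the summands at [N] does not affect the event
    [csum = k]. *)
Lemma cpmf_ffun N k : (k < N)%N ->
  cpmf k = \sum_(z : {ffun 'I_K -> 'I_N} | isum z == k) \prod_i pois (lambda i) (z i).
Proof.
move=> kN; apply: EFin_inj; rewrite cpmfE -sumEFin.
pose A (z : {ffun 'I_K -> 'I_N}) : set T :=
  if isum z == k then \bigcap_(i in [set i | i \in [set: 'I_K]%SET]) (Z i @^-1` [set nat_of_ord (z i)])
  else set0.
have AP z t : A z t <-> isum z = k /\ forall i, Z i t = z i.
  rewrite /A; case: eqP => h; split=> //=.
  - by move=> hz; split=> // i; apply: hz; rewrite /= inE.
  - by move=> [_ hz] i _; apply: hz.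
  - by case.
have -> : [set t | csum t = k] = \bigcup_z A z.
  apply/seteqP; split=> t /=; last first.
    move=> [z _ /AP[<- hz]]; rewrite /csum /isum.
    by apply: eq_bigr => i _; rewrite hz.
  move=> tk; have ltN i : (Z i t < N)%N.
    apply: leq_ltn_trans kN; rewrite -tk /csum (bigD1 i)//=.
    by rewrite (leq_trans _ (leq_addr _ _))// leq_pmull.
  exists [ffun i => Ordinal (ltN i)] => //; apply/AP; split=> [|i]; last by rewrite ffunE.
  by rewrite -tk; apply: eq_bigr => i _; rewrite ffunE.
rewrite probability_fin_bigcup.
- rewrite [RHS]big_mkcond; apply: eq_bigr => z _; rewrite /A.
  case: ifP => _; last by rewrite measure0.
  rewrite Z_indep// -prodEFin; under eq_bigl do rewrite inE.
  by apply: eq_bigr => i _; exact: poisson_law_pois.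
- move=> z; rewrite /A; case: ifP => // _.
  by apply: fin_bigcap_measurable => [|i _]; [exact: finite_finset|exact: measurable_funPTI].
- move=> z z' t /AP[_ h] /AP[_ h']; apply/ffunP => i; apply: val_inj => /=.
  by rewrite -h -h'.
Qed.

Lemma cpmf0 : cpmf 0 = \prod_i expR (- lambda i).
Proof.
rewrite (@cpmf_ffun 1)// (big_pred1 [ffun=> ord0]) => [|z].
  by apply: eq_bigr => i _; rewrite ffunE /pois expr0 divr1 mul1r.
have zE : z = [ffun=> ord0] by apply/ffunP => i; rewrite ffunE ord1.
transitivity true; last by apply/esym/eqP.
by apply/eqP; rewrite /isum big1// => i _; rewrite zE ffunE muln0.
Qed.

Lemma cpmf0_gt0 : 0 < cpmf 0.
Proof. by rewrite cpmf0; apply: prodr_gt0 => i _; apply: expR_gt0. Qed.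

Lemma cpmf0_le1 : cpmf 0 <= 1.
Proof.
rewrite -lee_fin cpmfE probability_le1//; exact: (measurable_csum [set 0%N]).
Qed.



Lemma leq_isum N (z : {ffun 'I_K -> 'I_N}) (i : 'I_K) : (i.+1 * z i <= isum z)%N.
Proof. by rewrite /isum (bigD1 i)//= leq_addr. Qed.

(** [f] is the successor or the predecessor in what follows; [inord] sends a
    value exceeding [N] to [0]. *)
Definition shift_coord N (i : 'I_K) (f : nat -> nat) (z : {ffun 'I_K -> 'I_N.+1}) :
    {ffun 'I_K -> 'I_N.+1} :=
  [ffun j => if j == i then inord (f (z j)) else z j].

Lemma isum_shift_coord N (i : 'I_K) (f : nat -> nat) (z : {ffun 'I_K -> 'I_N.+1}) : (f (z i) <= N)%N ->
  (isum (shift_coord i f z) + i.+1 * z i = isum z + i.+1 * f (z i))%N.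
Proof.
move=> fN; rewrite /isum (bigD1 i)//= [in RHS](bigD1 i)//= !ffunE eqxx inordK//.
rewrite (eq_bigr (fun j : 'I_K => j.+1 * z j)%N) => [|j /negbTE ji]; last by rewrite ffunE ji.
lia.
Qed.

(** Size biasing: the identity [m.+1 * pois l m.+1 = l * pois l m] turns the
    weight [z i] into the removal of one unit from the [i]-th coordinate. *)
Lemma size_bias k (i : 'I_K) :
  \sum_(z : {ffun 'I_K -> 'I_k.+1} | isum z == k)
    (z i)%:R * \prod_j pois (lambda j) (z j) = lambda i * shift_pmf cpmf k i.
Proof.
rewrite (bigID (fun z : {ffun 'I_K -> 'I_k.+1} => z i == ord0))/=.
rewrite big1 ?add0r => [|z /andP[_ /eqP ->]]; last by rewrite mul0r.
rewrite /shift_pmf; case: ltnP => ik; last first.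
  rewrite mulr0 big1// => z /andP[/eqP zk z0]; exfalso.
  have := leq_isum z i; rewrite zk => h.
  have : (0 < z i)%N by rewrite lt0n.
  by move: h ik; nia.
rewrite (@cpmf_ffun k.+1) ?ltnS ?leq_subr// mulr_sumr.
rewrite (reindex_onto (shift_coord i succn) (shift_coord i predn)) /=; last first.
  move=> z /andP[_ z0]; apply/ffunP => j; rewrite !ffunE.
  case: (eqVneq j i) => [->|//]; apply: val_inj => /=; have z0' : (0 < z i)%N by rewrite lt0n.
  have zk := ltn_ord (z i).
  by rewrite (inordK (leq_ltn_trans (leq_pred _) zk)) prednK// inordK.
(* If z i = k, the successor overflows to ord0, which the second test excludes. *)
have cond (z : {ffun 'I_K -> 'I_k.+1}) :
    [&& isum (shift_coord i succn z) == k, shift_coord i succn z i != ord0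
      & shift_coord i predn (shift_coord i succn z) == z] =
    (isum z == (k - i.+1)%N) && (z i < k)%N.
  rewrite ffunE eqxx; case: (ltnP (z i) k) => zk; last first.
    have zik : z i = k :> nat by have := ltn_ord (z i); lia.
    rewrite andbF (_ : inord _ = ord0) ?eqxx ?andbF//.
    by rewrite /inord /insubd insubF// zik ltnn.
  have -> : shift_coord i predn (shift_coord i succn z) == z.
    apply/eqP/ffunP => j; rewrite !ffunE; case: (eqVneq j i) => [->|//].
    by apply: val_inj; rewrite /= !inordK//= ltnS// ltnW.
  have -> : inord (z i).+1 != ord0 :> 'I_k.+1.
    by apply/eqP => /(congr1 val); rewrite /= inordK.
  rewrite !andbT; have := @isum_shift_coord k i succn z zk; rewrite mulnS.
  by move=> h; apply/eqP/eqP; lia.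
rewrite (eq_bigl (fun z : {ffun 'I_K -> 'I_k.+1} => isum z == (k - i.+1)%N)) => [|z]; last first.
  rewrite -andbA cond; case: eqP => //= zk; have := leq_isum z i; rewrite zk.
  by move=> h; nia.
apply: eq_bigr => z /eqP zk.
have zik : (z i < k)%N by have := leq_isum z i; rewrite zk; nia.
rewrite (bigD1 i)//= [in RHS](bigD1 i)//= ffunE eqxx inordK// mulrA poisS -mulrA.
congr (_ * (_ * _)); apply: eq_bigr => j /negbTE ji; by rewrite ffunE ji.
Qed.

Lemma cpmf_panjer k : k%:R * cpmf k = panjer lambda cpmf k.
Proof.
rewrite (@cpmf_ffun k.+1)// mulr_sumr /panjer.
transitivity (\sum_(z : {ffun 'I_K -> 'I_k.+1} | isum z == k) \sum_(i < K)
    i.+1%:R * ((z i)%:R * \prod_j pois (lambda j) (z j))).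
  apply: eq_bigr => z /eqP zk; rewrite -[X in X%:R * _]zk /isum natr_sum mulr_suml.
  by apply: eq_bigr => i _; rewrite natrM mulrA.
rewrite exchange_big /=; apply: eq_bigr => i _.
by rewrite -mulr_sumr size_bias mulrA.
Qed.

Lemma cdf_compound_sum (M : nat) (x : R) :
  (forall k : nat, k%:R <= x <-> (k < M)%N) ->
  cdf (compound_sum Z : {RV Q >-> R}) x = (\sum_(k < M) cpmf k)%:E.
Proof.
move=> hM; rewrite cpmf_sum /cdf /distribution /pushforward; congr (Q _).
apply/seteqP; split=> t /=; rewrite in_itv /= csumE.
  by move/hM.
by move=> h; apply/hM.
Qed.

End CompoundPoisson.
(** * Convergence in distribution *)

(** An integer-valued distribution function at [x] is a finite sum of point
    probabilities. *)
Lemma exists_nat_cutoff (R : realType) (x : R) :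
  exists M : nat, forall k : nat, k%:R <= x <-> (k < M)%N.
Proof.
case: (ltP x 0) => [x0|x0]; last by exists (Num.truncn x).+1 => k; rewrite ltnS truncn_ge_nat.
by exists 0%N => k; split=> // /le_lt_trans/(_ x0); rewrite ltrn0.
Qed.

Local Open Scope classical_set_scope.

Theorem mainTheorem10 (R : realType) (r K : nat)
  (hr : (2 <= r)%N) (hK : (1 <= K)%N)
  (V : nat -> finType) (H : forall n, hypergraph (V n))
  (hH : forall n, is_uniform r (H n))
  (w : forall n, {set V n} -> nat)
  (hw : forall n e, e \in H n -> (1 <= w n e <= K)%N)
  (c : nat -> nat) (hc : c n @[n --> \oo] --> \oo)
  (d : nat -> measure_display) (T : forall n, measurableType (d n))
  (P : forall n, probability (T n) R)
  (X : forall n, V n -> {RV (P n) >-> nat})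
  (hX : forall n, random_coloring (P n) (c n) (X n))
  (lambda : 'I_K -> R) (hlambda : forall i, 0 <= lambda i)
  (hE : forall i : 'I_K,
     ('E_(P n)[mono_count (X n) (weight_class (H n) (w n) i.+1)])%E
       @[n --> \oo] --> (lambda i)%:E)
  (hV : forall i : 'I_K,
     ('V_(P n)[mono_count (X n) (weight_class (H n) (w n) i.+1)])%E
       @[n --> \oo] --> (lambda i)%:E)
  (d' : measure_display) (T' : measurableType d') (Q : probability T' R)
  (Z : 'I_K -> {RV Q >-> nat})
  (hZ : forall i, poisson_law Q (lambda i) (Z i))
  (hZind : mutually_independent Q Z) :
  cvg_in_distribution P Q
    (fun n => weighted_mono_count (X n) (H n) (w n)) (compound_sum Z).
Proof.
have hc2 : \forall n \near \oo, (0 < c n)%N by move/cvgnyPge: hc => /(_ 1%N).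
have mean_cvg (i : 'I_K) : avg (count R (weight_class (H n) (w n) i.+1) :
    {ffun V n -> 'I_(c n)} -> R) @[n --> \oo] --> lambda i.
  apply: (@fine_cvg _ _ _ _ (fun n => (avg (count R _ : {ffun V n -> 'I_(c n)} -> R))%:E)).
  have := hE i; apply: cvg_trans; apply: near_eq_cvg; near=> n.
  by rewrite (expectation_mono_count _ (hX n))//; near: n.
have var_cvg (i : 'I_K) : avg (fun phi : {ffun V n -> 'I_(c n)} =>
    (count R (weight_class (H n) (w n) i.+1) phi -
     avg (count R (weight_class (H n) (w n) i.+1) : {ffun V n -> 'I_(c n)} -> R)) ^+ 2)
    @[n --> \oo] --> lambda i.
  apply: (@fine_cvg _ _ _ _ (fun n => (avg (fun phi : {ffun V n -> 'I_(c n)} => _))%:E)).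
  have := hV i; apply: cvg_trans; apply: near_eq_cvg; near=> n.
  by rewrite (variance_mono_count _ (hX n))//; near: n.
move=> x _; have [M hM] := exists_nat_cutoff x.
rewrite (cdf_compound_sum Z hM).
have pmf_cvg : forall k, @pmf R (V n) (c n) (H n) (w n) k @[n --> \oo] --> cpmf Z k.
  apply: (@panjer_pmf_cvg R K _
    (fun n i => #|weight_class (H n) (w n) i.+1|%:R * (c n)%:R^-1 ^+ r.-1) lambda).
  - by near=> n => k; exact: pmf_ge0.
  - move=> eps eps0; exact: (pmf_mass hr hH hw hc mean_cvg).
  - move=> k; exact: (pmf_panjer_cvg0 hr hH hw hc mean_cvg var_cvg).
  - move=> i; exact: (class_mean_cvg hr hH hc mean_cvg).
  - by rewrite (cpmf0_gt0 hlambda hZ hZind) cpmf0_le1.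
  - exact: cpmf_mass.
  - exact: cpmf_panjer hlambda hZ hZind.
have : (\sum_(k < M) @pmf R (V n) (c n) (H n) (w n) k)%:E @[n --> \oo] -->
    (\sum_(k < M) cpmf Z k)%:E.
  by apply: cvg_EFin; [exact: nearW|apply: cvg_sum => k; exact: pmf_cvg].
apply: cvg_trans; apply: near_eq_cvg; near=> n.
by rewrite (cdf_weighted_mono_count _ (hX n) _ _ hM)//; near: n.
Unshelve. all: by end_near. Qed.
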